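(* Let $Z:I^n\to\mathbb{R}^c$ be the logit map of a ReLU network, let $x_0\in I^n$ with $t:=\kappa(x_0)\in\{1,\dots,c\}$, and let $F(x)=\|x-x_0\|_2^2+a\,f(x)$ with $f(x)=\max\{Z_t(x)-\max_{i\neq t}Z_i(x),\,0\}$. Then for every sufficiently large penalty parameter $a>0$ the following holds. Let $(\alpha_k)$ be a non-increasing sequence of positive step sizes with $\lim_{k\to\infty}\alpha_k=0$, $\sum_{k}\alpha_k=\infty$ and $\sum_k\alpha_k^2<\infty$, and let $(x_k)_{k\ge 0}$ be any sequence starting at $x_0$ with $$x_{k+1}=P(x_k-\alpha_kG_k),\qquad G_k\in\nabla_CF(x_k),\qquad k=0,1,\dots$$ Then every accumulation point of $(x_k)$ that lies in $(0,1)^n$ is a stationary point of $F$.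
   Context: $I=[0,1]$, $n\ge1$, $c\ge2$. A ReLU network gives a continuous map $Z=(Z_1,\dots,Z_c):I^n\to\mathbb{R}^c$ (the logits) such that $I^n$ is a union of finitely many convex polytopes $Q_j$ with $Z$ affine on each $Q_j$. The full network is $\varphi=\mathrm{softmax}\circ Z$. The class map is $\kappa(x)=i$ if $\varphi_i(x)>\varphi_j(x)$ for all $j\ne i$ (equivalently $Z_i(x)>Z_j(x)$ for all $j\neq i$), and $\kappa(x)=0$ if no such $i$ exists. $P$ is the orthogonal projection of $\mathbb{R}^n$ onto $I^n$. For a locally Lipschitz function $g$, the Clarke generalized gradient is $\nabla_Cg(x)=\mathrm{conv}\{\lim_{i\to\infty}\nabla g(x_i): x_i\to x,\ \nabla g(x_i)\text{ exists}\}$. The elements of $\nabla_CF(x)$ are the vectors $a\,g+2(x-x_0)$ with $g\in\nabla_Cf(x)$. The normal cone is $N_{I^n}(x)=\{z\in\mathbb{R}^n: z^T(z'-x)\le0\ \forall z'\in I^n\}$. A point $x\in I^n$ is a stationary point of $F$ (on $I^n$) if $0\in\nabla_CF(x)+N_{I^n}(x)$. *)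

(* Defs.v *)
From HB Require Import structures.
From mathcomp Require Import all_boot all_order all_algebra.
From mathcomp Require Import all_classical all_reals all_analysis.

Set Implicit Arguments.
Unset Strict Implicit.
Unset Printing Implicit Defensive.
Import Order.TTheory GRing.Theory Num.Theory.
Import numFieldNormedType.Exports.
Local Open Scope classical_set_scope.
Local Open Scope ring_scope.

(* Points of R^n are row vectors 'rV[R]_n.  The library norm `|x| on 'rV[R]_n
   is the max norm (it induces the usual topology); Euclidean quantities are
   therefore written with [dot] and [sqnorm]. *)
Section Euclidean.
Context {R : realType} {n : nat}.

Definition dot (u v : 'rV[R]_n) : R := \sum_(i < n) u 0 i * v 0 i.

Definition sqnorm (u : 'rV[R]_n) : R := dot u u.

Definition unit_cube : set 'rV[R]_n := [set x | forall i, 0 <= x 0 i <= 1].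

Definition open_cube : set 'rV[R]_n := [set x | forall i, 0 < x 0 i < 1].

(* For K closed, convex and nonempty the set below is a singleton. *)
Definition orth_proj (K : set 'rV[R]_n) (y : 'rV[R]_n) : 'rV[R]_n :=
  get [set p | K p /\ forall z, K z -> sqnorm (y - p) <= sqnorm (y - z)].

Definition normal_cone (K : set 'rV[R]_n) (x : 'rV[R]_n) : set 'rV[R]_n :=
  [set z | forall z', K z' -> dot z (z' - x) <= 0].

Definition convex_hull (A : set 'rV[R]_n) : set 'rV[R]_n :=
  smallest (@convex_set R 'rV[R]_n) A.

Definition gradient (g : 'rV[R]_n -> R) (x : 'rV[R]_n) : 'rV[R]_n :=
  \row_(i < n) ('D_(delta_mx 0 i) g x : R).

(* Clarke generalized gradient of a function defined on K only.  Being
   represented by a total function, g has meaningless values outside K, so the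
   approximating points u i are taken in the interior of K, where
   differentiability and the gradient depend only on the restriction of g to K;
   the base point x may lie on the boundary of K. *)
Definition clarke_gradient (K : set 'rV[R]_n) (g : 'rV[R]_n -> R)
    (x : 'rV[R]_n) : set 'rV[R]_n :=
  convex_hull [set v | exists u : nat -> 'rV[R]_n,
    [/\ forall i, K° (u i) /\ differentiable g (u i),
        u @ \oo --> x
      & (fun i => gradient g (u i)) @ \oo --> v]].

Definition stationary_point (K : set 'rV[R]_n) (g : 'rV[R]_n -> R)
    (x : 'rV[R]_n) : Prop :=
  exists u z, [/\ clarke_gradient K g x u, normal_cone K x z & u + z = 0].

Definition polyhedron (Q : set 'rV[R]_n) : Prop :=
  exists (m : nat) (A : 'M[R]_(n, m)) (b : 'rV[R]_m),
    Q = [set x | forall i, (x *m A) 0 i <= b 0 i].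

Definition polytope (Q : set 'rV[R]_n) : Prop := bounded_set Q /\ polyhedron Q.

End Euclidean.

Definition affine_on {R : realType} {n c : nat} (Q : set 'rV[R]_n)
    (f : 'rV[R]_n -> 'rV[R]_c) : Prop :=
  exists (A : 'M[R]_(n, c)) (b : 'rV[R]_c), forall x, Q x -> f x = x *m A + b.

Definition piecewise_affine_on {R : realType} {n c : nat} (K : set 'rV[R]_n)
    (f : 'rV[R]_n -> 'rV[R]_c) : Prop :=
  exists (m : nat) (Q : 'I_m -> set 'rV[R]_n),
    K = \bigcup_(j in [set: 'I_m]) Q j /\
    forall j, polytope (Q j) /\ affine_on (Q j) f.

(* The architecture is left open: a ReLU network enters through the map it
   gives on the cube, continuous and piecewise affine with polytopal pieces
   (values of Z off the cube are irrelevant).  For the standard feedforward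
   architecture, [relu_eval_logit_map] below proves these two properties. *)
Definition relu_logit_map {R : realType} {n c : nat}
    (Z : 'rV[R]_n -> 'rV[R]_c) : Prop :=
  {within unit_cube, continuous Z} /\ piecewise_affine_on unit_cube Z.

Definition softmax {R : realType} {c : nat} (z : 'rV[R]_c) : 'rV[R]_c :=
  \row_i (expR (z 0 i) / \sum_(j < c) expR (z 0 j)).

(* The class None encodes the value 0 of the class map (no strict maximum);
   classes 1, ..., c are the elements of 'I_c. *)
Definition class_map {R : realType} {n c : nat} (Z : 'rV[R]_n -> 'rV[R]_c)
    (x : 'rV[R]_n) : option 'I_c :=
  let phi := softmax (Z x) in
  [pick i | [forall j, (j != i) ==> (phi 0 j < phi 0 i)]].

(* The supremum is over a finite set, nonempty as soon as 1 < c: it is the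
   maximum of the logits of the classes other than t. *)
Definition margin {R : realType} {n c : nat} (Z : 'rV[R]_n -> 'rV[R]_c)
    (t : 'I_c) (x : 'rV[R]_n) : R :=
  Num.max (Z x 0 t - sup [set Z x 0 i | i in [set i | i != t]]) 0.

Definition penalized {R : realType} {n c : nat} (Z : 'rV[R]_n -> 'rV[R]_c)
    (t : 'I_c) (x0 : 'rV[R]_n) (a : R) (x : 'rV[R]_n) : R :=
  sqnorm (x - x0) + a * margin Z t x.

Section ReLUNetworks.
Context {R : realType}.

Inductive relu_net : nat -> nat -> Type :=
| Output n c (W : 'M[R]_(n, c)) (b : 'rV[R]_c) : relu_net n c
| Hidden n m c (W : 'M[R]_(n, m)) (b : 'rV[R]_m) (N : relu_net m c) :
    relu_net n c.

Definition relu {m : nat} (y : 'rV[R]_m) : 'rV[R]_m := map_mx (Num.max 0) y.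

Fixpoint relu_eval n c (N : relu_net n c) : 'rV[R]_n -> 'rV[R]_c :=
  match N with
  | Output _ _ W b => fun x => x *m W + b
  | Hidden _ _ _ W b N' => fun x => relu_eval N' (relu (x *m W + b))
  end.

Let continuous_rV (T : topologicalType) n (f : T -> 'rV[R]_n) :
  (forall i, continuous (fun t => f t 0 i)) -> continuous f.
Proof.
move=> fc x; apply/(@cvg_ballP R 'rV[R]_n) => e e0.
have : \forall t \near x, forall i, ball (f x 0 i) e (f t 0 i).
  apply: (@filter_forall _ _ (fun i => [set t | ball (f x 0 i) e (f t 0 i)])) => i.
  by have /(@cvg_ballP R R)/(_ _ e0) := fc i x.
apply: filterS => t H; split=> // i j; rewrite ord1; exact: H.
Qed.

Let coord_rV (T : topologicalType) n (f : T -> 'rV[R]_n) i :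
  continuous f -> continuous (fun t => f t 0 i).
Proof.
move=> fc x; apply: (@continuous_comp _ _ _ f (fun y : 'rV_n => y 0 i)); first exact: fc.
exact: coord_continuous.
Qed.

Let affine_continuous (T : topologicalType) n m (f : T -> 'rV[R]_n)
    (W : 'M[R]_(n, m)) (b : 'rV[R]_m) :
  continuous f -> continuous (fun x => f x *m W + b).
Proof.
move=> fc; apply: continuous_rV => i; under eq_fun do rewrite !mxE.
move=> x; apply: cvgD; last exact: cvg_cst.
apply: cvg_big => [|j _]; first exact: add_continuous.
apply: cvgM; [exact: coord_rV|exact: cvg_cst].
Qed.

Let relu_continuous (T : topologicalType) n (f : T -> 'rV[R]_n) :
  continuous f -> continuous (fun x => relu (f x)).
Proof.
move=> fc; apply: continuous_rV => i; under eq_fun do rewrite !mxE.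
move=> x; apply: (@continuous_max _ _ (cst 0) (fun x => f x 0 i)).
  exact: cvg_cst.
exact: coord_rV.
Qed.

Let relu_eval_continuous n c (N : relu_net n c) :
  forall (T : topologicalType) (f : T -> 'rV[R]_n),
  continuous f -> continuous (fun x => relu_eval N (f x)).
Proof.
elim: N => {n c} [n c W b|n m c W b N IH] T f fc /=.
  exact: affine_continuous.
by apply: IH; apply: relu_continuous; exact: affine_continuous.
Qed.

Let unit_cube_bounded n : bounded_set (@unit_cube R n).
Proof.
exists 1; split; first exact: num_real.
move=> M M1 x xK; apply: ltW; apply: le_lt_trans M1.
rewrite /Num.norm/= mx_normrE; apply: bigmax_le => // -[i j] _ /=.
by rewrite ord1; have /andP[x0 x1] := xK j; rewrite ger0_norm.
Qed.

Let polyhedronI n (P Q : set 'rV[R]_n) :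
  polyhedron P -> polyhedron Q -> polyhedron (P `&` Q).
Proof.
move=> [m1 [A1 [b1 ->]]] [m2 [A2 [b2 ->]]].
exists (m1 + m2)%N, (row_mx A1 A2), (row_mx b1 b2).
apply/seteqP; split=> x /=; rewrite mul_mx_row.
  move=> [H1 H2] i; case: (split_ordP i) => j ->.
    by rewrite !row_mxEl.
  by rewrite !row_mxEr.
move=> H; split=> i; first by have := H (lshift m2 i); rewrite !row_mxEl.
by have := H (rshift m1 i); rewrite !row_mxEr.
Qed.

Let cube_polyhedron n : polyhedron (@unit_cube R n).
Proof.
rewrite (_ : unit_cube = [set x | forall i, (x *m 1%:M) 0 i <= (const_mx 1 : 'rV[R]_n) 0 i]
    `&` [set x | forall i, (x *m (- 1%:M)) 0 i <= (0 : 'rV[R]_n) 0 i]).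
  by apply: polyhedronI; do 3 eexists.
apply/seteqP; split=> x /=; rewrite mulmxN mulmx1.
  by move=> xK; split=> i; rewrite !mxE ?oppr_le0; case/andP: (xK i).
move=> [H1 H2] i; have := H1 i; have := H2 i.
by rewrite !mxE oppr_le0 => -> ->.
Qed.

Let pieces n c (K : set 'rV[R]_n) (f : 'rV[R]_n -> 'rV[R]_c) :=
  exists (m : nat) (Q : 'I_m -> set 'rV[R]_n),
    K = \bigcup_(j in [set: 'I_m]) Q j /\
    forall j, polyhedron (Q j) /\ affine_on (Q j) f.

Let pieces0 n c (f : 'rV[R]_n -> 'rV[R]_c) : pieces set0 f.
Proof.
exists 0%N, (fun=> set0); split; last by case.
by rewrite bigcup0.
Qed.

Let piecesU n c (f : 'rV[R]_n -> 'rV[R]_c) K L :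
  pieces K f -> pieces L f -> pieces (K `|` L) f.
Proof.
move=> [m1 [Q1 [-> H1]]] [m2 [Q2 [-> H2]]].
exists (m1 + m2)%N, (fun j : 'I_(m1 + m2) => match fintype.split j with inl i => Q1 i | inr i => Q2 i end).
split; last by move=> j; case: (fintype.split j).
apply/seteqP; split=> x /=.
  case=> -[i _ xi]; first by exists (lshift m2 i) => //; rewrite (unsplitK (inl i)).
  by exists (rshift m1 i) => //; rewrite (unsplitK (inr i)).
by case=> j _; case: (fintype.split j) => i xi; [left|right]; exists i.
Qed.

Let relu_eval_pieces n c (N : relu_net n c) :
  forall k (P : set 'rV[R]_k) (A : 'M[R]_(k, n)) (b : 'rV[R]_n),
  polyhedron P -> pieces P (fun x => relu_eval N (x *m A + b)).
Proof.
elim: N => {n c} [n c W b'|n m c W b' N IH] k P A b PP /=.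
  exists 1%N, (fun=> P); split; first by rewrite bigcup_const//; exists ord0.
  move=> _; split=> //; exists (A *m W), (b *m W + b') => x _.
  by rewrite mulmxDl mulmxA addrA.
pose y (x : 'rV[R]_k) := (x *m A + b) *m W + b'.
pose H (s : {ffun 'I_m -> bool}) : set 'rV[R]_k :=
  [set x | forall i, if s i then 0 <= y x 0 i else y x 0 i <= 0].
have yE x : y x = x *m (A *m W) + (b *m W + b').
  by rewrite /y mulmxDl mulmxA addrA.
have -> : P = \big[setU/set0]_(s : {ffun 'I_m -> bool}) (P `&` H s).
  rewrite -bigcup_seq; apply/seteqP; split=> x /= => [Px|[s _ []//]].
  exists [ffun i => 0 <= y x 0 i]; first by rewrite /= mem_index_enum.
  by split=> // i; rewrite ffunE; case: leP => // /ltW.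
apply: (big_ind (fun S => pieces S _)); [exact: pieces0|by move=> *; exact: piecesU|].
move=> s _.
pose D : 'M[R]_m := diag_mx (\row_i (s i)%:R).
have PH : polyhedron (P `&` H s).
  apply: polyhedronI => //.
  pose S : 'M[R]_m := diag_mx (\row_i (-1) ^+ s i).
  exists m, (A *m W *m S), (- ((b *m W + b') *m S)).
  have zE x i : ((x *m (A *m W *m S)) 0 i <= (- ((b *m W + b') *m S)) 0 i) =
      (y x 0 i * (-1) ^+ s i <= 0).
    have -> : y x 0 i * (-1) ^+ s i =
        (x *m (A *m W *m S)) 0 i + ((b *m W + b') *m S) 0 i.
      have <- : (y x *m S) 0 i = y x 0 i * (-1) ^+ s i.
        by rewrite mul_mx_diag !mxE.
      by rewrite yE mulmxDl mxE !mulmxA.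
    set v := (b *m W + b') *m S.
    by rewrite -subr_le0 (_ : (- v) 0 i = - v 0 i) ?opprK // mxE.
  apply/seteqP; split=> x /= Hx i; have := Hx i; rewrite zE;
    by case: (s i); rewrite ?expr1 ?expr0 ?mulr1 ?mulrN1 ?oppr_le0.
have [q [Q [PE HQ]]] := IH _ (P `&` H s) (A *m W *m D) ((b *m W + b') *m D) PH.
exists q, Q; split=> // j; have [Qp [A' [b'' Qa]]] := HQ j; split=> //.
exists A', b'' => x Qx; rewrite -Qa//; congr relu_eval.
rewrite mulmxA -mulmxDl -yE; apply/rowP => i.
have [Px /(_ i)] : (P `&` H s) x by rewrite PE; exists j.
have -> : (y x *m D) 0 i = y x 0 i * (s i)%:R by rewrite mul_mx_diag !mxE.
rewrite [LHS]mxE -/(y x).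
case: (s i) => Hi; last by rewrite mulr0 max_l.
by rewrite mulr1 max_r.
Qed.

Lemma relu_eval_logit_map n c (N : relu_net n c) : relu_logit_map (relu_eval N).
Proof.
split; first by apply/continuous_subspaceT/(@relu_eval_continuous _ _ N _ id) => x; exact: cvg_id.
have [m [Q [KE H]]] := relu_eval_pieces N 1%:M 0 (cube_polyhedron n).
exists m, Q; split=> // j; have [Qp [A [b Qa]]] := H j; split.
  split=> //; have [M [Mr HM]] := unit_cube_bounded n.
  exists M; split=> // M' /HM + x Qx; apply.
  by rewrite KE; exists j.
by exists A, b => x /Qa; rewrite mulmx1 addr0.
Qed.

End ReLUNetworks.

(* Main.v *)
(* F is a continuous selection among finitely many smooth pieces, each a
   quadratic plus an affine function, and every projected subgradient step is a
   combination of gradients of pieces touching the graph of F at x_k and of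
   normals of faces that x_k nearly touches.  Over a time window of length
   h = sum of the alpha_k, as long as every piece and face used in the window is
   used near both of its ends, F changes by the same amount as the corresponding
   piece, and pairing the steps with x_e - x_b gives
   F(x_e) - F(x_b) <= - |x_e - x_b|^2 / h + o(h); otherwise one splits the
   window and inducts on the number of indices used.  Near a point that is not
   critical, |x_e - x_b| >= const * h by compactness of the set of multipliers,
   so F decreases at a definite rate.  Only finitely many values of F are
   critical, because on a fixed set of pieces the strongly convex F has at most
   one critical point; hence F(x_k) cannot oscillate around a noncritical level,
   and no cluster point is noncritical.  Any a > 0 works. *)
Require Import Defs.
From HB Require Import structures.
From mathcomp Require Import all_boot all_order all_algebra.
From mathcomp Require Import all_classical all_reals all_analysis.
From mathcomp Require Import ring lra.

Set Implicit Arguments.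
Unset Strict Implicit.
Unset Printing Implicit Defensive.
Import Order.TTheory GRing.Theory Num.Theory.
Import numFieldNormedType.Exports.
Local Open Scope classical_set_scope.
Local Open Scope ring_scope.

(** * Euclidean inner product on row vectors and its comparison with the max norm *)

Section DotProduct.
Context {R : realType} {n : nat}.
Implicit Types u v w : 'rV[R]_n.

Lemma dotC u v : dot u v = dot v u.
Proof. by apply: eq_bigr => i _; rewrite mulrC. Qed.

Lemma dotDl u v w : dot (u + v) w = dot u w + dot v w.
Proof. by rewrite /dot -big_split; apply: eq_bigr => i _; rewrite mxE mulrDl. Qed.

Lemma dotZl (a : R) u v : dot (a *: u) v = a * dot u v.
Proof. by rewrite /dot big_distrr; apply: eq_bigr => i _; rewrite mxE /= mulrA. Qed.

Lemma dotNl u v : dot (- u) v = - dot u v.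
Proof. by rewrite -scaleN1r dotZl mulN1r. Qed.

Lemma dotBl u v w : dot (u - v) w = dot u w - dot v w.
Proof. by rewrite dotDl dotNl. Qed.

Lemma dotDr u v w : dot w (u + v) = dot w u + dot w v.
Proof. by rewrite !(dotC w) dotDl. Qed.

Lemma dotZr (a : R) u v : dot v (a *: u) = a * dot v u.
Proof. by rewrite !(dotC v) dotZl. Qed.

Lemma dotNr u v : dot v (- u) = - dot v u.
Proof. by rewrite !(dotC v) dotNl. Qed.

Lemma dotBr u v w : dot w (u - v) = dot w u - dot w v.
Proof. by rewrite !(dotC w) dotBl. Qed.

Lemma dot0l v : dot 0 v = 0.
Proof. by rewrite -(scale0r v) dotZl mul0r. Qed.

Lemma dot_suml (I : Type) (r : seq I) (P : pred I) (F : I -> 'rV[R]_n) v :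
  dot (\sum_(i <- r | P i) F i) v = \sum_(i <- r | P i) dot (F i) v.
Proof.
by elim/big_rec2: _ => [|i y1 y2 _ <-]; rewrite ?dot0l // dotDl.
Qed.

Lemma dot_delta i v : dot (delta_mx 0 i) v = v 0 i.
Proof.
rewrite /dot (bigD1 i) //= big1 ?addr0; first by rewrite mxE !eqxx mul1r.
by move=> j ji; rewrite mxE (negPf ji) andbF mul0r.
Qed.

Lemma sqnorm_ge0 u : 0 <= sqnorm u.
Proof. by apply: sumr_ge0 => i _; rewrite -expr2 sqr_ge0. Qed.

Lemma sqnorm_eq0 u : sqnorm u = 0 -> u = 0.
Proof.
move=> /eqP; rewrite psumr_eq0 => [/allP H|i _]; last by rewrite -expr2 sqr_ge0.
apply/rowP => i; have := H i (mem_index_enum _).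
by rewrite /= mulf_eq0 orbb mxE => /eqP.
Qed.

Lemma sqnormD u v : sqnorm (u + v) = sqnorm u + 2 * dot u v + sqnorm v.
Proof. by rewrite /sqnorm !(dotDl, dotDr) (dotC v u); ring. Qed.

Lemma sqnormB u v : sqnorm (u - v) = sqnorm u - 2 * dot u v + sqnorm v.
Proof. by rewrite sqnormD /sqnorm dotNl !dotNr; ring. Qed.

Lemma sqnormZ (a : R) u : sqnorm (a *: u) = a ^+ 2 * sqnorm u.
Proof. by rewrite /sqnorm dotZl dotZr; ring. Qed.

Lemma coord_le_norm u i : `|u 0 i| <= `|u|.
Proof.
rewrite [`|u|]mx_normrE.
by apply: (@le_bigmax _ _ _ 0 (fun ij : 'I_1 * 'I_n => `|u ij.1 ij.2|) (0, i)).
Qed.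

Lemma norm_le_coord u (r : R) : 0 <= r -> (forall i, `|u 0 i| <= r) -> `|u| <= r.
Proof.
by move=> r0 H; rewrite [`|u|]mx_normrE; apply: bigmax_le => // -[i j] _ /=; rewrite ord1.
Qed.

Lemma dot_le_norm u v : `|dot u v| <= n%:R * (`|u| * `|v|).
Proof.
apply: (le_trans (ler_norm_sum _ _ _)).
rewrite mulr_natl -[X in _ *+ X]card_ord -sumr_const.
by apply: ler_sum => i _; rewrite normrM ler_pM // coord_le_norm.
Qed.

Lemma sqnorm_le_norm u : sqnorm u <= n%:R * `|u| ^+ 2.
Proof. by rewrite expr2; apply: le_trans (ler_norm _) (dot_le_norm u u). Qed.

(** Joint convexity of [|u|^2 / h]: multiplied by [h + k], the two sides differ by
    [|k u - h v|^2 / (h k)]. *)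
Lemma sqnorm_div_add u v (h k : R) : 0 < h -> 0 < k ->
  sqnorm (u + v) / (h + k) <= sqnorm u / h + sqnorm v / k.
Proof.
move=> h0 k0; have hk : 0 < h + k by rewrite addr_gt0.
have H := sqnorm_ge0 (k *: u - h *: v).
rewrite sqnormB !sqnormZ dotZl dotZr in H.
rewrite ler_pdivrMr // sqnormD -subr_ge0.
have -> : (sqnorm u / h + sqnorm v / k) * (h + k) - (sqnorm u + 2 * dot u v + sqnorm v)
  = (k ^+ 2 * sqnorm u - 2 * (k * (h * dot u v)) + h ^+ 2 * sqnorm v) / (h * k).
  by field; rewrite !gt_eqF.
by rewrite divr_ge0 // mulr_ge0 // ltW.
Qed.

End DotProduct.

(** * The energy inequality over time windows *)

(* An index [q] is either a smooth piece of the objective ([kappa q = 1], with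
   [phi q] the gap between the objective and the piece and [W q] the gradient of
   the piece) or a face of the constraint set ([kappa q = 0], with [phi q] the
   slack and [W q] the normal); [mu q k] is its multiplier in the step [k]. *)
Section Energy.
Context {R : realType} {n : nat}.
Variables (Q : finType) (alpha : nat -> R) (x : nat -> 'rV[R]_n) (F : nat -> R).
Variables (phi mu : Q -> nat -> R) (W : Q -> nat -> 'rV[R]_n) (kappa : Q -> R).
Variable C : R.

Definition elapsed (b e : nat) : R := \sum_(b <= i < e) alpha i.

Definition touched (b e : nat) : {set Q} :=
  [set q | has (fun k => mu q k != 0) (index_iota b e)]%SET.

Hypothesis alpha_gt0 : forall k, 0 < alpha k.
Hypothesis C0 : 0 <= C.
Hypothesis x_lip : forall k, `|x k.+1 - x k| <= C * alpha k.
Hypothesis F_lip : forall k, `|F k.+1 - F k| <= C * alpha k.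
Hypothesis phi_lip : forall q k, `|phi q k.+1 - phi q k| <= C * alpha k.
Hypothesis stepE : forall k, x k.+1 - x k = - (alpha k *: \sum_q mu q k *: W q k).
Hypothesis mu_bound : forall q k, 0 <= mu q k <= C.
Hypothesis mu_phi : forall q k, mu q k != 0 -> `|phi q k| <= C * alpha k.
Hypothesis kappa_mu : forall k, \sum_q kappa q * mu q k = 1.
(** First-order expansion over a window. The piece [q] equals the objective minus [phi q], so its
    increment is [dot (W q k) (x e - x b)] up to second order; for a face, the slack changes by
    exactly minus the normal component of the displacement. *)
Hypothesis chain : forall q b k e, (b <= k < e)%N ->
  `|dot (W q k) (x e - x b) - kappa q * (F e - F b) + (phi q e - phi q b)|
    <= C * elapsed b e ^+ 2.

Lemma elapsed_cat b c e : (b <= c)%N -> (c <= e)%N ->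
  elapsed b e = elapsed b c + elapsed c e.
Proof. by move=> bc ce; rewrite /elapsed (big_cat_nat _ ce). Qed.

Lemma elapsed_ge0 b e : 0 <= elapsed b e.
Proof. by apply: sumr_ge0 => i _; exact: ltW. Qed.

Lemma elapsed_gt0 b e : (b < e)%N -> 0 < elapsed b e.
Proof.
move=> be; rewrite /elapsed big_ltn //.
by apply: ltr_wpDr => //; exact: elapsed_ge0.
Qed.

Lemma elapsed1 b : elapsed b b.+1 = alpha b.
Proof. by rewrite /elapsed big_nat1. Qed.

Lemma telescope_le (V : normedModType R) (s : nat -> V) b e :
  (forall k, `|s k.+1 - s k| <= C * alpha k) -> (b <= e)%N ->
  `|s e - s b| <= C * elapsed b e.
Proof.
move=> H be; rewrite -telescope_sumr // /elapsed big_distrr /=.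
by apply: (le_trans (ler_norm_sum _ _ _)); apply: ler_sum.
Qed.

Lemma touchedP q b e : reflect (exists2 k, (b <= k < e)%N & mu q k != 0) (q \in touched b e).
Proof.
rewrite inE; apply: (iffP hasP) => -[k].
  by rewrite mem_index_iota; exists k.
by exists k => //; rewrite mem_index_iota.
Qed.

Lemma untouched q b e k : q \notin touched b e -> (b <= k < e)%N -> mu q k = 0.
Proof.
by move=> + kbe; apply: contraNeq => m0; apply/touchedP; exists k.
Qed.

(** One factor of [|D|^2] is expanded into steps. By [chain] each [dot (W q k) D] equals
    [kappa q * dF] up to the change of [phi q] and [O(h^2)]; as the weights [kappa q * mu q k] add
    up to 1, this gives [|D|^2 = - h * dF] up to errors. *)
Lemma energy_block b e (w : R) : (b < e)%N -> 0 <= w ->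
  (forall q, q \in touched b e -> `|phi q e - phi q b| <= w) ->
  F e - F b <= - (sqnorm (x e - x b) / elapsed b e)
     + #|Q|%:R * C * (w + C * elapsed b e ^+ 2).
Proof.
move=> be w0 Hw; set h := elapsed b e; set D := x e - x b; set dF := F e - F b.
have h0 : 0 < h by exact: elapsed_gt0.
have CQ : 0 <= w + C * h ^+ 2 by rewrite addr_ge0 // mulr_ge0 // sqr_ge0.
have DE : D = \sum_(b <= k < e) - (alpha k *: \sum_q mu q k *: W q k).
  by rewrite /D -telescope_sumr; [apply: eq_bigr|exact: ltnW].
have sqE : sqnorm D = - \sum_(b <= k < e) alpha k * \sum_q mu q k * dot (W q k) D.
  rewrite {1}/sqnorm {1}DE dot_suml -sumrN; apply: eq_bigr => k _.
  rewrite dotNl dotZl dot_suml; congr (- (_ * _)).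
  by apply: eq_bigr => q _; rewrite dotZl.
have dFE : h * dF = \sum_(b <= k < e) alpha k * \sum_q mu q k * (kappa q * dF).
  rewrite /h /elapsed big_distrl /=; apply: eq_bigr => k _; congr (_ * _).
  rewrite -[LHS]mul1r -(kappa_mu k) big_distrl /=.
  by apply: eq_bigr => q _; rewrite mulrA [kappa q * mu _ _]mulrC.
have key : sqnorm D + h * dF <= h * (#|Q|%:R * C * (w + C * h ^+ 2)).
  rewrite sqE dFE addrC -sumrB.
  rewrite [X in _ <= X * _](_ : h = \sum_(b <= k < e) alpha k) // [leRHS]big_distrl /=.
  rewrite big_nat [leRHS]big_nat; apply: ler_sum => k kbe.
  rewrite -mulrBr ler_pM2l // -sumrB.
  have -> : #|Q|%:R * C * (w + C * h ^+ 2) = \sum_(q : Q) C * (w + C * h ^+ 2).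
    by rewrite sumr_const -mulrA mulr_natl.
  apply: ler_sum => q _; rewrite -mulrBr.
  have [mu0 muC] := andP (mu_bound q k).
  have [qt|qt] := boolP (q \in touched b e); last first.
    by rewrite (untouched qt kbe) mul0r mulr_ge0.
  apply: (@le_trans _ _ (mu q k * (w + C * h ^+ 2))); last exact: ler_wpM2r.
  apply: ler_wpM2l => //.
  have := chain q kbe; rewrite -/h -/D -/dF ler_norml => /andP[H1 _].
  have := Hw q qt; rewrite ler_norml => /andP[_ H2]; lra.
rewrite -(ler_pM2l h0) [leRHS]mulrDr mulrN [h * (_ / h)]mulrC divfK ?gt_eqF //.
by rewrite [leRHS]addrC lerBrDl.
Qed.

Definition energy_err (b e : nat) (r : R) : Prop :=
  F e - F b <= - (sqnorm (x e - x b) / elapsed b e) + r.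

(** The main terms combine by [sqnorm_div_add], so the errors of consecutive windows just add up. *)
Lemma energy_cat b c e (r s : R) : (b < c)%N -> (c < e)%N ->
  energy_err b c r -> energy_err c e s -> energy_err b e (r + s).
Proof.
move=> bc ce; rewrite /energy_err (elapsed_cat (ltnW bc) (ltnW ce)) => H1 H2.
have := sqnorm_div_add (x c - x b) (x e - x c) (elapsed_gt0 bc) (elapsed_gt0 ce).
rewrite [x c - x b + _]addrC addrA subrK; lra.
Qed.

(** Meant for windows whose length is comparable to the step sizes, where an error linear in the
    length is a multiple of [A]. *)
Lemma energy_crude b e : (b < e)%N ->
  energy_err b e ((C + n%:R * C ^+ 2) * elapsed b e).
Proof.
move=> be; have h0 := elapsed_gt0 be; rewrite /energy_err.
have := telescope_le F_lip (ltnW be); rewrite ler_norml => /andP[_ HF].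
have Hx := telescope_le x_lip (ltnW be).
have : sqnorm (x e - x b) / elapsed b e <= n%:R * C ^+ 2 * elapsed b e.
  rewrite ler_pdivrMr //.
  have -> : n%:R * C ^+ 2 * elapsed b e * elapsed b e = n%:R * (C * elapsed b e) ^+ 2 by ring.
  by apply: (le_trans (sqnorm_le_norm _)); rewrite ler_wpM2l // lerXn2r ?nnegrE // mulr_ge0 // ltW.
lra.
Qed.

Lemma touchedS b c d e : (b <= c)%N -> (d <= e)%N -> touched c d \subset touched b e.
Proof.
move=> bc de; apply/fintype.subsetP => q /touchedP[k /andP[ck kd] m0].
by apply/touchedP; exists k => //; rewrite (leq_trans bc ck) (leq_trans kd de).
Qed.

Lemma touched_card_lt b c d e q : (b <= c)%N -> (d <= e)%N ->
  q \in touched b e -> q \notin touched c d -> (#|touched c d| < #|touched b e|)%N.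
Proof.
move=> bc de qb qc; apply: proper_card; apply/fintype.properP; split; first exact: touchedS.
by exists q.
Qed.

(* Either every index touched on [b, e) is touched within time [eta * h] of both
   ends, or a piece of duration at least [eta * h] on which some touched index
   is inactive splits off at one end. *)
Lemma split_alternative b e (eta A : R) : 0 <= eta -> (b < e)%N ->
  (forall i, (b <= i < e)%N -> alpha i <= A) ->
  [\/ forall q, q \in touched b e ->
        `|phi q e - phi q b| <= C * (3 * A + 2 * eta * elapsed b e),
     exists2 c, (b < c < e)%N & eta * elapsed b e <= elapsed b c /\
        (#|touched b c| < #|touched b e|)%N
   | exists2 c, (b < c < e)%N & eta * elapsed b e <= elapsed c e /\
        (#|touched c e| < #|touched b e|)%N].
Proof.
move=> eta0 be HA.
have [H2|N2] := pselect (exists2 c, (b < c < e)%N & eta * elapsed b e <= elapsed b c /\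
        (#|touched b c| < #|touched b e|)%N); first by constructor 2.
have [H3|N3] := pselect (exists2 c, (b < c < e)%N & eta * elapsed b e <= elapsed c e /\
        (#|touched c e| < #|touched b e|)%N); first by constructor 3.
constructor 1 => q qt.
have [k0 kbe0 mk0] := touchedP _ _ _ qt.
have A0 : 0 <= A by apply: le_trans (HA _ kbe0); exact: ltW.
have eh0 : 0 <= eta * elapsed b e by rewrite mulr_ge0 // elapsed_ge0.
have Hb : `|phi q b| <= C * (A + eta * elapsed b e).
  have ex : exists k, (b <= k < e)%N && (mu q k != 0) by exists k0; rewrite kbe0.
  case: (ex_minnP ex) => k /andP[kbe mk] kmin.
  have [bk ke] := andP kbe.
  have Hk : `|phi q k| <= C * A.
    by apply: (le_trans (mu_phi mk)); rewrite ler_wpM2l // HA.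
  have Hbk : elapsed b k <= eta * elapsed b e.
    rewrite leNgt; apply/negP => lt.
    have bk' : (b < k)%N.
      rewrite ltn_neqAle bk andbT; apply/negP => /eqP E.
      have z : elapsed b k = 0 by rewrite E /elapsed big_geq.
      by move: lt; rewrite z ltNge eh0.
    apply: N2; exists k; first by rewrite bk'.
    split; first exact: ltW.
    apply: touched_card_lt qt _ => //; first exact: ltnW.
    apply/negP => /touchedP[k' /andP[bk1 k'k] mk'].
    have := kmin k'; rewrite bk1 (ltn_trans k'k ke) mk' => /(_ isT).
    by rewrite leqNgt k'k.
  have := telescope_le (phi_lip q) bk; rewrite distrC => Hd.
  have -> : phi q b = phi q k + (phi q b - phi q k) by rewrite addrC subrK.
  rewrite mulrDr; apply: (le_trans (ler_normD _ _)); apply: lerD => //.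
  by apply: (le_trans Hd); rewrite ler_wpM2l.
(* One more [A] than at [b]: [q] is touched during the step [k] itself, so the window free of [q]
   starts only at [k.+1]. *)
have He : `|phi q e| <= C * (2 * A + eta * elapsed b e).
  have ex : exists k, (b <= k < e)%N && (mu q k != 0) by exists k0; rewrite kbe0.
  have ub k : (b <= k < e)%N && (mu q k != 0) -> (k <= e)%N.
    by move=> /andP[/andP[_ /ltnW]].
  case: (ex_maxnP ex ub) => k /andP[kbe mk] kmax.
  have [bk ke] := andP kbe.
  have Hk : `|phi q k| <= C * A.
    by apply: (le_trans (mu_phi mk)); rewrite ler_wpM2l // HA.
  have Hbk : elapsed k.+1 e <= eta * elapsed b e.
    rewrite leNgt; apply/negP => lt.
    have bk' : (k.+1 < e)%N.
      rewrite ltn_neqAle ke andbT; apply/negP => /eqP E.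
      have z : elapsed k.+1 e = 0 by rewrite E /elapsed big_geq.
      by move: lt; rewrite z ltNge eh0.
    apply: N3; exists k.+1; first by rewrite ltnS bk.
    split; first exact: ltW.
    apply: touched_card_lt qt _ => //; first exact: leqW.
    apply/negP => /touchedP[k' /andP[bk1 k'k] mk'].
    have := kmax k'; rewrite (leq_trans bk (ltnW bk1)) k'k mk' => /(_ isT).
    by rewrite leqNgt bk1.
  have := telescope_le (phi_lip q) (ltnW ke) => Hd.
  have -> : phi q e = phi q k + (phi q e - phi q k) by rewrite addrC subrK.
  have -> : C * (2 * A + eta * elapsed b e) = C * A + C * (A + eta * elapsed b e) by ring.
  apply: (le_trans (ler_normD _ _)); apply: lerD => //.
  apply: (le_trans Hd); rewrite ler_wpM2l // (elapsed_cat (leqnSn k) ke) elapsed1.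
  by apply: lerD => //; exact: HA.
apply: (le_trans (ler_normB _ _)).
have -> : C * (3 * A + 2 * eta * elapsed b e) =
  C * (2 * A + eta * elapsed b e) + C * (A + eta * elapsed b e) by ring.
exact: lerD.
Qed.

(** Induction on the number of touched indices, then on the number of steps. A piece that splits off
    touches fewer indices and lasts at least [eta * h], which absorbs its error [B1 * A] into the
    [eps] term. Only the last remainder pays [B * A], so these errors do not accumulate over
    repeated splittings. *)
Lemma energy_touched (r : nat) (eps : R) : 0 < eps ->
  exists2 H : R, 0 < H & exists2 B : R, 0 <= B &
    forall b e A, (b < e)%N -> (forall i, (b <= i < e)%N -> alpha i <= A) ->
      elapsed b e <= H -> (#|touched b e| < r)%N ->
      energy_err b e (eps * elapsed b e + B * A).
Proof.
elim: r eps => [|r IH] eps eps0; first by exists 1 => //; exists 0.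
have [H1 H10 [B1 B10 P1]] := IH (eps / 2) (divr_gt0 eps0 (ltr0Sn _ _)).
pose K := #|Q|%:R * C.
have K0 : 0 <= K by rewrite mulr_ge0.
(* [eta] and [H] are chosen so that [(K * C + 1) * (2 * eta + H) <= eps], which controls the error
   of [energy_block] when no split occurs. *)
pose eta := eps / (4 * (K * C + 1)).
pose H := Num.min H1 (eps / (2 * (K * C + 1))).
have KC1 : 0 < K * C + 1 by rewrite ltr_wpDl // mulr_ge0.
have eta0 : 0 < eta by rewrite divr_gt0 // mulr_gt0.
have H0 : 0 < H by rewrite lt_min H10 divr_gt0 // mulr_gt0.
(* For windows longer than [th * A] one has [B1 * A <= eps / 2 * (eta * h)]; shorter windows are
   left to [energy_crude]. *)
pose th := 2 * B1 / (eps * eta).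
have th0 : 0 <= th by apply: divr_ge0; apply: mulr_ge0; rewrite ?(ltW eps0) ?(ltW eta0).
pose B := 3 * (K * C) + (C + n%:R * C ^+ 2) * th.
have c10 : 0 <= C + n%:R * C ^+ 2 by rewrite addr_ge0 // mulr_ge0 // sqr_ge0.
have B0 : 0 <= B by apply: addr_ge0; apply: mulr_ge0 => //; apply: mulr_ge0.
exists H => //; exists B => // b e A be HA hH hr.
(* The remainder after a split may touch as many indices as before, but it has fewer steps. *)
have [m em] := ubnP (e - b)%N.
elim: m => // m IHm in b e be HA hH hr em *.
have h0 := elapsed_gt0 be; set h := elapsed b e in h0 hH *.
have A0 : 0 <= A by apply: le_trans (HA b _); rewrite ?leqnn //; exact: ltW.
have BA0 : 0 <= B * A by exact: mulr_ge0.
have [small|large] := leP h (th * A).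
  have := energy_crude be; rewrite /energy_err -/h => /le_trans; apply; rewrite lerD2l.
  have : (C + n%:R * C ^+ 2) * h <= (C + n%:R * C ^+ 2) * (th * A) by exact: ler_wpM2l.
  have : 0 <= eps * h by rewrite mulr_ge0 // ltW.
  have : 0 <= 3 * (K * C) * A by rewrite !mulr_ge0.
  rewrite /B mulrDl; lra.
have piece b' e' : (b <= b')%N -> (e' <= e)%N -> (b' < e')%N -> eta * h <= elapsed b' e' ->
    (#|touched b' e'| < #|touched b e|)%N -> energy_err b' e' (eps * elapsed b' e').
  move=> bb' ee' be' hl ht.
  have HA' i : (b' <= i < e')%N -> alpha i <= A.
    by move=> /andP[? ?]; apply: HA; rewrite (leq_trans bb') ?(leq_trans _ ee').
  have hle : elapsed b' e' <= h.
    rewrite /h (elapsed_cat bb' (leq_trans (ltnW be') ee')) (elapsed_cat (ltnW be') ee').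
    by rewrite addrCA lerDl addr_ge0 // elapsed_ge0.
  have hH1 : elapsed b' e' <= H1.
    by apply: (le_trans hle); apply: (le_trans hH); rewrite ge_min lexx.
  have := P1 b' e' A be' HA' hH1 (leq_trans ht hr).
  move=> /le_trans; apply; rewrite lerD2l.
  have : B1 * A <= eps / 2 * (eta * (th * A)).
    by rewrite le_eqVlt; apply/orP; left; apply/eqP; rewrite /th; field; rewrite !gt_eqF.
  have : eps / 2 * (eta * (th * A)) <= eps / 2 * elapsed b' e'.
    rewrite ler_pM2l ?divr_gt0 //; apply: le_trans hl; rewrite ler_pM2l //; exact: ltW.
  lra.
case: (split_alternative (ltW eta0) be HA) =>
    [good|[c /andP[bc ce] [hl ht]]|[c /andP[bc ce] [hl ht]]].
- have w0 : 0 <= C * (3 * A + 2 * eta * h).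
    apply: mulr_ge0 => //; apply: addr_ge0; first exact: mulr_ge0.
    by rewrite mulr_ge0 ?(ltW h0) // mulr_ge0 // ltW.
  have := energy_block be w0 good; rewrite -/h => /le_trans; apply; rewrite lerD2l -/K.
  have -> : K * (C * (3 * A + 2 * eta * h) + C * h ^+ 2) =
      (K * C) * (2 * eta + h) * h + 3 * (K * C) * A by ring.
  apply: lerD; last first.
    by apply: ler_wpM2r => //; rewrite /B lerDl mulr_ge0.
  rewrite ler_pM2r //; apply: (@le_trans _ _ ((K * C + 1) * (2 * eta + h))).
    apply: ler_wpM2r; last by rewrite lerDl.
    by rewrite addr_ge0 ?(ltW h0) // mulr_ge0 // ltW.
  have h2 : h <= eps / (2 * (K * C + 1)).
    by apply: (le_trans hH); rewrite ge_min lexx orbT.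
  apply: (@le_trans _ _ ((K * C + 1) * (2 * eta + eps / (2 * (K * C + 1))))).
    by rewrite ler_pM2l // lerD2l.
  by rewrite le_eqVlt; apply/orP; left; apply/eqP; rewrite /eta; field; rewrite gt_eqF.
- have E1 : energy_err b c (eps * elapsed b c) by apply: piece => //; exact: ltnW.
  have E2 : energy_err c e (eps * elapsed c e + B * A).
    apply: IHm => //.
    + by move=> i /andP[ci ie]; apply: HA; rewrite ie (leq_trans (ltnW bc) ci).
    + apply: le_trans hH; rewrite /h (elapsed_cat (ltnW bc) (ltnW ce)) lerDr.
      exact: elapsed_ge0.
    + by apply: leq_ltn_trans hr; apply: subset_leq_card; apply: touchedS => //; exact: ltnW.
    + by apply: (@leq_trans (e - b)%N); [exact: ltn_sub2l|rewrite -ltnS].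
  have := energy_cat bc ce E1 E2; rewrite /h (elapsed_cat (ltnW bc) (ltnW ce)).
  by rewrite addrA -mulrDr.
- have E1 : energy_err c e (eps * elapsed c e) by apply: piece => //; exact: ltnW.
  have E2 : energy_err b c (eps * elapsed b c + B * A).
    apply: IHm => //.
    + by move=> i /andP[ci ie]; apply: HA; rewrite ci (ltn_trans ie ce).
    + apply: le_trans hH; rewrite /h (elapsed_cat (ltnW bc) (ltnW ce)) lerDl.
      exact: elapsed_ge0.
    + by apply: leq_ltn_trans hr; apply: subset_leq_card; apply: touchedS => //; exact: ltnW.
    + by apply: (@leq_trans (e - b)%N); [exact: ltn_sub2r|rewrite -ltnS].
  have := energy_cat bc ce E2 E1; rewrite /h (elapsed_cat (ltnW bc) (ltnW ce)).
  by rewrite addrAC -mulrDr.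
Qed.

Lemma energy_inequality (eps : R) : 0 < eps ->
  exists2 H : R, 0 < H & exists2 B : R, 0 <= B &
    forall b e A, (b < e)%N -> (forall i, (b <= i < e)%N -> alpha i <= A) ->
      elapsed b e <= H ->
      F e - F b <= - (sqnorm (x e - x b) / elapsed b e) + (eps * elapsed b e + B * A).
Proof.
move=> eps0; have [H H0 [B B0 P]] := energy_touched #|Q|.+1 eps0.
exists H => //; exists B => // b e A be HA hH.
by apply: P => //; rewrite ltnS; exact: max_card.
Qed.

End Energy.

(** * Descent near noncritical points and exclusion of noncritical cluster points *)

Lemma finite_set_avoid {R : realType} (A : set R) (a b : R) :
  finite_set A -> a < b -> exists2 v, a < v < b & ~ A v.
Proof.
move=> /finite_seqP[s ->] ab.
(* The right end is lowered to each listed point that falls inside the interval. *)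
have [b' /andP[ab' b'b] H] : exists2 b', a < b' <= b & forall v, a < v < b' -> v \notin s.
  elim: s => [|y s [b' /andP[ab' b'b] H]]; first by exists b; rewrite ?ab ?lexx.
  have [/andP[ay yb]|ny] := boolP (a < y < b').
    exists y; first by rewrite ay (le_trans (ltW yb)).
    move=> v /andP[av vy]; rewrite inE negb_or (lt_eqF vy) H // av; exact: lt_trans yb.
  exists b'; first by rewrite ab'.
  move=> v vb; rewrite inE negb_or H // andbT.
  by apply: contraNneq ny => <-.
have [l u] := midf_lt ab'; exists ((a + b') / 2); first by rewrite l (lt_le_trans u).
by apply/negP/H; rewrite l u.
Qed.

Section Descent.
Context {R : realType} {n : nat}.
Variables (alpha : nat -> R) (x : nat -> 'rV[R]_n) (f : 'rV[R]_n -> R).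
Variables (K crit : set 'rV[R]_n) (C : R).
Hypothesis alpha_gt0 : forall k, 0 < alpha k.
Hypothesis alpha_noninc : forall k, alpha k.+1 <= alpha k.
Hypothesis alpha_cvg0 : alpha @ \oo --> (0 : R).
Hypothesis alpha_div : series alpha @ \oo --> +oo.
Hypothesis K_compact : compact K.
Hypothesis xK : forall k, K (x k).
Hypothesis C0 : 0 < C.
Hypothesis x_lip : forall k, `|x k.+1 - x k| <= C * alpha k.
Hypothesis fx_lip : forall k, `|f (x k.+1) - f (x k)| <= C * alpha k.
Hypothesis f_lip : forall y z, K y -> K z -> `|f y - f z| <= C * `|y - z|.
Hypothesis energy : forall eps : R, 0 < eps ->
  exists2 H : R, 0 < H & exists2 B : R, 0 <= B &
    forall b e A, (b < e)%N -> (forall i, (b <= i < e)%N -> alpha i <= A) ->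
      elapsed alpha b e <= H ->
      f (x e) - f (x b) <= - (sqnorm (x e - x b) / elapsed alpha b e)
        + (eps * elapsed alpha b e + B * A).
Hypothesis nondegenerate : forall y, K y -> ~ crit y ->
  exists (d r : R) N, [/\ 0 < d, 0 < r & forall b e, (N <= b < e)%N ->
    (forall i, (b <= i < e)%N -> `|x i - y| <= r) ->
    d * elapsed alpha b e ^+ 2 <= sqnorm (x e - x b)].
Hypothesis crit_values : finite_set (f @` (K `&` crit)).

Lemma alpha_le b i : (b <= i)%N -> alpha i <= alpha b.
Proof.
elim: i => [|i IH]; first by rewrite leqn0 => /eqP ->.
rewrite leq_eqVlt => /predU1P[-> //|]; rewrite ltnS => /IH; exact: le_trans.
Qed.

Lemma alpha_small (e : R) : 0 < e -> exists N, forall k, (N <= k)%N -> alpha k < e.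
Proof.
move=> e0; have /cvgrPdist_lt/(_ _ e0)[N _ H] := alpha_cvg0.
exists N => k Nk; have := H k Nk; rewrite sub0r normrN ger0_norm //; exact: ltW.
Qed.

(** The first [e] that reaches [h] overshoots by at most its last step, and steps do not grow. *)
Lemma elapsed_reach b (h : R) : 0 < h ->
  exists e, [/\ (b < e)%N, h <= elapsed alpha b e & elapsed alpha b e <= h + alpha b].
Proof.
move=> h0.
have ex : exists e, h <= elapsed alpha b e.
  have /cvgryPge/(_ (h + series alpha b))[N _ H] := alpha_div.
  have := H (maxn N b) (leq_maxl _ _).
  rewrite /series /= (big_cat_nat (leq0n b) (leq_maxr N b)) /= -/(elapsed alpha b _).
  by exists (maxn N b); lra.
case: (ex_minnP ex) => e he emin; exists e.
have be : (b < e)%N.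
  by rewrite ltnNge; apply/negP => eb; move: he; rewrite /elapsed big_geq // leNgt h0.
split=> //; case: e be emin {he} => // e be emin.
rewrite (elapsed_cat alpha (be : (b <= e)%N) (leqnSn e)) elapsed1 lerD ?alpha_le //.
by rewrite leNgt; apply/negP => /ltW/emin; rewrite ltnn.
Qed.

(** The energy inequality with [eps = d / 4] on a window of length [h] between [h0] and [2 * h0]:
    nondegeneracy contributes [- d * h], the errors are at most [d * h / 4 + d * h0 / 4], so [f]
    drops by at least [d * h0 / 2]. *)
Lemma local_descent y (sigma : R) : K y -> ~ crit y -> 0 < sigma ->
  exists (r c : R) N, [/\ 0 < r, 0 < c & forall k, (N <= k)%N -> `|x k - y| < r ->
    exists m, [/\ (k < m)%N, f (x m) <= f (x k) - c &
      forall i, (k <= i <= m)%N -> f (x i) <= f (x k) + sigma]].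
Proof.
move=> Ky nc s0; have [d [r [N [d0 r0 Hnd]]]] := nondegenerate Ky nc.
have [H H0 [B B0 Hen]] := energy (divr_gt0 d0 (ltr0Sn _ 3)).
(* The three entries make a window of length [2 * h0] admissible for [energy], keep the path within
   [r] of [y], and let [f] rise by at most [sigma]. *)
pose h0 := Num.min (H / 2) (Num.min (r / (4 * C)) (sigma / (2 * C))).
have h00 : 0 < h0 by rewrite !lt_min !divr_gt0 // mulr_gt0.
have [N1 HN1] := alpha_small h00.
have [|N2 HN2] := @alpha_small (d * h0 / (4 * (B + 1))) _.
  by rewrite divr_gt0 ?mulr_gt0 // ltr_wpDl.
exists (r / 2), (d * h0 / 2), (maxn N (maxn N1 N2)).
split; [by rewrite divr_gt0|by rewrite divr_gt0 ?mulr_gt0|].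
move=> k; rewrite !geq_max => /and3P[Nk N1k N2k] xky.
have [m [km hm hm2]] := elapsed_reach k h00.
have {}hm2 : elapsed alpha k m <= 2 * h0 by have := HN1 _ N1k; lra.
have sub i : (k <= i <= m)%N -> C * elapsed alpha k i <= C * (2 * h0).
  move=> /andP[ki im]; rewrite ler_pM2l //; apply: le_trans hm2.
  by rewrite (elapsed_cat alpha ki im) lerDl elapsed_ge0.
have Ch1 : C * (2 * h0) <= r / 2.
  have : h0 <= r / (4 * C) by rewrite ge_min ge_min lexx orbT.
  by rewrite ler_pdivlMr ?mulr_gt0 //; lra.
have Ch2 : C * (2 * h0) <= sigma.
  have : h0 <= sigma / (2 * C) by rewrite ge_min ge_min lexx !orbT.
  by rewrite ler_pdivlMr ?mulr_gt0 //; lra.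
have hH : elapsed alpha k m <= H.
  have : h0 <= H / 2 by rewrite ge_min lexx.
  lra.
exists m; split=> //; last first.
  move=> i kim; have [ki im] := andP kim; have := sub i kim.
  have := telescope_le (s := fun k => f (x k)) fx_lip ki.
  by rewrite ler_norml => /andP[_]; lra.
have := Hnd k m; rewrite Nk km => /(_ isT) near_y.
have /near_y D : forall i, (k <= i < m)%N -> `|x i - y| <= r.
  move=> i /andP[ki im]; have := sub i; rewrite ki ltnW // => /(_ isT) s.
  have := telescope_le x_lip ki => t.
  by rewrite -(subrK (x k) (x i)) -addrA; apply: (le_trans (ler_normD _ _)); lra.
have he : 0 < elapsed alpha k m by exact: lt_le_trans hm.
have := Hen k m (alpha k) km.
have HA i : (k <= i < m)%N -> alpha i <= alpha k by move=> /andP[? _]; exact: alpha_le.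
move=> /(_ HA hH).
have : d * elapsed alpha k m <= sqnorm (x m - x k) / elapsed alpha k m.
  by rewrite ler_pdivlMr // -mulrA -expr2.
have : B * alpha k <= d * h0 / 4.
  have := HN2 _ N2k; rewrite ltr_pdivlMr ?mulr_gt0 ?ltr_wpDl // => HB.
  have := alpha_gt0 k; have : 0 <= B * alpha k by rewrite mulr_ge0 // ltW.
  lra.
have : d * h0 <= d * elapsed alpha k m by rewrite ler_pM2l.
lra.
Qed.

(** Compactness along the subsequence of indices that satisfy [P]; applied to the upcrossing
    times. *)
Lemma cluster_along (P : nat -> Prop) : (forall N, exists2 i, (N <= i)%N & P i) ->
  exists2 y, K y & forall N (e : R), 0 < e ->
    exists i, [/\ (N <= i)%N, P i & `|x i - y| < e].
Proof.
move=> HP; have /choice[u Hu] : forall N, exists i, (N <= i)%N /\ P i.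
  by move=> N; have [i ? ?] := HP N; exists i.
have [|y [Ky cy]] := K_compact (F := (x \o u) @ \oo).
  by exists 0%N => // k _; exact: xK.
exists y => // N e e0.
have A : ((x \o u) @ \oo) [set z | exists i, [/\ (N <= i)%N, P i & z = x i]].
  exists N => // k /= Nk; exists (u k); have [ku Pu] := Hu k.
  by split=> //; exact: leq_trans ku.
have [z [[i [Ni Pi ->]] /= zy]] := cy _ _ A (nbhsx_ballx y e e0).
by exists i; split=> //; move: zy; rewrite -ball_normE /= distrC.
Qed.

(* If [f] dropped below its value at a noncritical cluster point infinitely
   often, it would also climb back infinitely often through a level [v] chosen
   not to be a critical value; these upcrossings accumulate at a noncritical
   point of level [v], where [f] has to decrease before it can climb. *)
Lemma cluster_crit p : K p -> cluster (x @ \oo) p -> crit p.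
Proof.
move=> Kp cp; apply: contrapT => np.
have freq N (e : R) : 0 < e -> exists2 k, (N <= k)%N & `|x k - p| < e.
  move=> e0; have A : (x @ \oo) [set z | exists2 i, (N <= i)%N & z = x i].
    by exists N => // k /= Nk; exists k.
  have [z [[i Ni ->] /= zy]] := cp _ _ A (nbhsx_ballx p e e0).
  by exists i => //; move: zy; rewrite -ball_normE /= distrC.
have [r [c [N [r0 c0 Hp]]]] := local_descent Kp np ltr01.
have fnear (e : R) M : 0 < e ->
    exists k, [/\ (M <= k)%N, `|x k - p| < r & `|f (x k) - f p| < e].
  move=> e0; have [|k Mk] := freq M (Num.min r (e / C)).
    by rewrite lt_min r0 divr_gt0.
  rewrite lt_min => /andP[kr ke]; exists k; split=> //; apply: (le_lt_trans (f_lip (xK k) Kp)).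
  by move: ke; rewrite ltr_pdivlMr // mulrC.
(* A descent starting near [p] ends below [f p - 3 c / 4], hence below [v], and every return near
   [p] exceeds [f p - c / 4], hence [v]: each excursion crosses [v] upwards. *)
have [|v /andP[v1 v2] nv] :=
  finite_set_avoid crit_values (_ : f p - c / 2 < f p - c / 4); first by lra.
pose upcross i := f (x i) <= v /\ v < f (x i.+1) /\
  exists k, [/\ (i < k)%N, f p - c / 4 < f (x k) & forall j, (i < j <= k)%N -> v < f (x j)].
have [M|y Ky Hy] := @cluster_along upcross.
  have [|k [Nk kr kf]] := fnear (c / 4) (maxn N M); first by rewrite divr_gt0.
  move: Nk; rewrite geq_max => /andP[Nk Mk].
  have [m [km fm _]] := Hp k Nk kr.
  have [|k' [mk' _ kf']] := fnear (c / 4) m.+1; first by rewrite divr_gt0.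
  have ex : exists i, (m <= i <= k')%N && (f (x i) <= v).
    exists m; rewrite leqnn (ltnW mk') /=.
    by move: kf; rewrite ltr_norml => /andP[_]; lra.
  have ub i : (m <= i <= k')%N && (f (x i) <= v) -> (i <= k')%N by case/andP => /andP[].
  case: (ex_maxnP ex ub) => i /andP[/andP[mi ik'] fi] imax.
  have fk' : f p - c / 4 < f (x k').
    by move: kf'; rewrite ltr_norml => /andP[+ _]; lra.
  have ik : (i < k')%N.
    rewrite ltn_neqAle ik' andbT; apply/eqP => E; move: fi; rewrite E; lra.
  have above j : (i < j <= k')%N -> v < f (x j).
    move=> /andP[ij jk]; rewrite ltNge; apply/negP => fj.
    have := imax j; rewrite jk fj (leq_trans mi (ltnW ij)) => /(_ isT).
    by rewrite leqNgt ij.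
  exists i; first by rewrite (leq_trans Mk) // (leq_trans (ltnW km)).
  by split=> //; split; [apply: above; rewrite leqnn|exists k'].
(* An upcrossing puts [v] between two consecutive values, whose difference tends to 0. *)
have fy : f y = v.
  apply/eqP; rewrite -subr_eq0 -normr_eq0 eq_le normr_ge0 andbT.
  apply/ler_addgt0Pr => e e0; rewrite add0r.
  have eC : 0 < e / (2 * C) by rewrite divr_gt0 // mulr_gt0.
  have [N1 HN1] := alpha_small eC.
  have [i [Ni [fi [fi1 _]] xy]] := Hy N1 _ eC.
  have := HN1 _ Ni; rewrite ltr_pdivlMr ?mulr_gt0 // => a1.
  move: xy; rewrite ltr_pdivlMr ?mulr_gt0 // => a2.
  have := f_lip (xK i) Ky; have := fx_lip i; rewrite !ler_norml.
  move=> /andP[a3 a4] /andP[a5 a6]; apply/andP; split; lra.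
have ny : ~ crit y by move=> cy; apply: nv; exists y.
(* With this [sigma] the descent window from an upcrossing cannot contain the index [k], where the
   level [f p - c / 4] is exceeded; so it ends before [k] or at [k], where all values are above [v],
   although it ends below [v]. *)
have [|r' [c' [N' [r'0 c'0 Hy']]]] := local_descent (sigma := f p - c / 4 - v) Ky ny.
  by rewrite subr_gt0.
have [i [Ni [fi [_ [k [ik fk above]]]] xy]] := Hy N' _ r'0.
have [m [im fm bm]] := Hy' i Ni xy.
have [mk|km] := leqP m k.
  by have := above m; rewrite im mk => /(_ isT); lra.
by have := bm k; rewrite (ltnW ik) (ltnW km) => /(_ isT); lra.
Qed.

End Descent.

(** * Lower bound on the displacement near a noncritical point *)

Lemma norm_le_sqnorm {R : realType} {n : nat} (u : 'rV[R]_n) : `|u| ^+ 2 <= sqnorm u.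
Proof.
rewrite -[sqnorm u]sqr_sqrtr ?sqnorm_ge0 // lerXn2r ?nnegrE ?sqrtr_ge0 //.
apply: norm_le_coord => [|i]; first exact: sqrtr_ge0.
rewrite -sqrtr_sqr ler_sqrt ?sqnorm_ge0 // /sqnorm /dot (bigD1 i) //= -expr2 lerDl.
by apply: sumr_ge0 => j _; rewrite -expr2 sqr_ge0.
Qed.

Lemma continuous_lincomb {R : realType} (T : topologicalType) (U : normedModType R)
    (I : Type) (r : seq I) (g : I -> T -> R) (v : I -> U) :
  (forall i, continuous (g i)) -> continuous (fun t => \sum_(i <- r) g i t *: v i).
Proof.
move=> gc t; apply: cvg_big => [|i _]; first exact: add_continuous.
by apply: cvgZr_tmp; exact: gc.
Qed.

Section Nondegenerate.
Context {R : realType} {n : nat}.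
Variables (Q : finType) (alpha : nat -> R) (x : nat -> 'rV[R]_n).
Variables (mu : Q -> nat -> R) (V : Q -> 'rV[R]_n -> 'rV[R]_n) (kappa : Q -> R).
Variables (active : 'rV[R]_n -> pred Q) (C M : R).
Hypothesis alpha_gt0 : forall k, 0 < alpha k.
Hypothesis M0 : 0 <= M.
Hypothesis V_lip : forall q y z, `|V q y - V q z| <= M * `|y - z|.
Hypothesis stepE : forall k, x k.+1 - x k = - (alpha k *: \sum_q mu q k *: V q (x k)).
Hypothesis mu_bound : forall q k, 0 <= mu q k <= C.
Hypothesis kappa_mu : forall k, \sum_q kappa q * mu q k = 1.

(** The Karush-Kuhn-Tucker condition: with [kappa] equal to 1 on pieces and 0 on faces, a convex
    combination of gradients of active pieces is cancelled by a nonnegative combination of normals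
    of active faces. *)
Definition balanced (y : 'rV[R]_n) : Prop := exists w : Q -> R,
  [/\ forall q, 0 <= w q, forall q, w q != 0 -> active y q,
      \sum_q kappa q * w q = 1 & \sum_q w q *: V q y = 0].

(** The admissible multipliers form a compact box, whose image under the pair of total weight and
    resultant is closed. It misses [(1, 0)] because [y] is not balanced, hence misses a ball around
    it. *)
Lemma separated y : ~ balanced y -> exists2 d : R, 0 < d &
  forall w : Q -> R, (forall q, 0 <= w q <= C) -> (forall q, w q != 0 -> active y q) ->
    \sum_q kappa q * w q = 1 -> d <= `|\sum_q w q *: V q y|.
Proof.
move=> nb.
(* Inactive indices get the degenerate interval [[0, 0]], which encodes the support condition in the
   box. *)
pose box : set 'rV[R]_#|Q| :=
  [set w | forall i, `[0, if active y (enum_val i) then C else 0]%classic (w 0 i)].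
have cbox : compact box.
  by apply: (@rV_compact _ _ (fun i => `[0, if active y (enum_val i) then C else 0]%classic)) => i;
    exact: segment_compact.
pose wt (w : 'rV[R]_#|Q|) q := w 0 (enum_rank q).
pose g (w : 'rV[R]_#|Q|) : R * 'rV[R]_n :=
  (\sum_q kappa q * wt w q, \sum_q wt w q *: V q y).
have gc : continuous g.
  have c1 : continuous (fun w => \sum_q kappa q * wt w q).
    rewrite (_ : (fun w => _) = fun w => \sum_q wt w q *: (kappa q : R^o)).
      by apply: continuous_lincomb => q; exact: coord_continuous.
    by apply/funext => w; apply: eq_bigr => q _; rewrite mulrC.
  have c2 : continuous (fun w => \sum_q wt w q *: V q y).
    by apply: continuous_lincomb => q; exact: coord_continuous.
  by move=> w; exact: (cvg_pair (c1 w) (c2 w)).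
have cl : closed (g @` box).
  apply: compact_closed; first exact: norm_hausdorff.
  apply: continuous_compact => //; exact: continuous_subspaceT.
have nin : (~` (g @` box)) (1, 0).
  move=> -[w bw [E1 E2]]; apply: nb; exists (wt w); split=> // q.
    by have := bw (enum_rank q); rewrite /= in_itv /= => /andP[].
  have := bw (enum_rank q); rewrite /= in_itv /= enum_rankK -/(wt w q).
  by case: (active y q) => // /andP[w0 w1]; rewrite eq_le w0 w1.
have /nbhs_ballP[d /= d0 Hd] := open_nbhs_nbhs (conj (closed_openC cl) nin).
exists d => // w wC wa w1; rewrite leNgt; apply/negP => lt.
pose w' : 'rV[R]_#|Q| := \row_i w (enum_val i).
have E q : wt w' q = w q by rewrite /wt mxE enum_rankK.
have Hb : ball ((1, 0) : R * 'rV[R]_n) d (g w').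
  split; rewrite /g /=; under eq_bigr do rewrite E.
    by rewrite w1; exact: ballxx.
  by rewrite -ball_normE /= sub0r normrN.
apply: (Hd _ Hb); exists w' => // i.
rewrite /= in_itv /= mxE.
have /andP[w0 wC'] := wC (enum_val i); rewrite w0 /=.
by case: ifPn => // /negP na; rewrite leNgt; apply/negP => /lt0r_neq0/wa.
Qed.

(** The displacement is [- h] times the resultant at [y] of the time-averaged multipliers [w], up to
    the variation of [V] near [y]. The averages are again admissible, so the resultant has norm at
    least [d], and the variation costs at most half of that. *)
Lemma nondegenerate y r0 N : 0 < r0 ->
  (forall k q, (N <= k)%N -> `|x k - y| <= r0 -> mu q k != 0 -> active y q) ->
  ~ balanced y ->
  exists (d r : R) N, [/\ 0 < d, 0 < r & forall b e, (N <= b < e)%N ->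
    (forall i, (b <= i < e)%N -> `|x i - y| <= r) ->
    d * elapsed alpha b e ^+ 2 <= sqnorm (x e - x b)].
Proof.
move=> r00 Hact nb; have [d d0 Hd] := separated nb.
pose P := #|Q|%:R * (`|C| * M).
have P0 : 0 <= P by rewrite !mulr_ge0.
(* The radius makes the variation at most [P * d / (2 * (P + 1)) <= d / 2] per unit of time. *)
exists (d ^+ 2 / 4), (Num.min r0 (d / (2 * (P + 1)))), N.
have P1 : 0 < P + 1 by rewrite ltr_wpDl.
split; first by rewrite divr_gt0 // exprn_gt0.
  by rewrite lt_min r00 divr_gt0 // mulr_gt0.
move=> b e /andP[Nb be] near_y; set h := elapsed alpha b e.
have h0 : 0 < h by exact: elapsed_gt0.
have near0 i : (b <= i < e)%N -> `|x i - y| <= r0.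
  by move=> /near_y/le_trans; apply; rewrite ge_min lexx.
have near1 i : (b <= i < e)%N -> `|x i - y| <= d / (2 * (P + 1)).
  by move=> /near_y/le_trans; apply; rewrite ge_min lexx orbT.
pose w q := (\sum_(b <= k < e) alpha k * mu q k) / h.
have hw q : h * w q = \sum_(b <= k < e) alpha k * mu q k.
  by rewrite mulrC divfK // gt_eqF.
have w0C q : 0 <= w q <= C.
  have s0 : 0 <= \sum_(b <= k < e) alpha k * mu q k.
    by apply: sumr_ge0 => k _; rewrite mulr_ge0 ?(ltW (alpha_gt0 k)) //; case/andP: (mu_bound q k).
  rewrite divr_ge0 ?(ltW h0) //= ler_pdivrMr // mulrC [h * _]big_distrl /=.
  by apply: ler_sum => k _; rewrite ler_pM2l //; case/andP: (mu_bound q k).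
have wact q : w q != 0 -> active y q.
  apply: contraNT => na; rewrite /w big_nat big1 ?mul0r // => k /andP[bk ke].
  have [->|m0] := eqVneq (mu q k) 0; first by rewrite mulr0.
  by have := Hact k q (leq_trans Nb bk) (near0 k _) m0; rewrite bk ke (negPf na) => /(_ isT).
have w1 : \sum_q kappa q * w q = 1.
  apply: (mulfI (lt0r_neq0 h0)); rewrite mulr1 big_distrr /=.
  under eq_bigr do rewrite mulrCA hw big_distrr /=.
  rewrite exchange_big /= /h /elapsed; apply: eq_bigr => k _.
  rewrite -[RHS]mulr1 -(kappa_mu k) big_distrr /=.
  by apply: eq_bigr => q _; rewrite mulrCA.
have DE : x e - x b = - (h *: \sum_q w q *: V q y)
    - \sum_(b <= k < e) alpha k *: \sum_q mu q k *: (V q (x k) - V q y).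
  rewrite -opprD -telescope_sumr ?(ltnW be) //.
  under eq_bigr do rewrite stepE.
  rewrite sumrN; congr (- _).
  rewrite scaler_sumr; under [X in _ = X + _]eq_bigr do rewrite scalerA hw scaler_suml.
  rewrite exchange_big -big_split /=; apply: eq_bigr => k _.
  rewrite scaler_sumr [X in _ = _ + X]scaler_sumr -big_split /=; apply: eq_bigr => q _.
  by rewrite -scalerA -scalerDr -scalerDr addrC subrK.
have err : `|\sum_(b <= k < e) alpha k *: \sum_q mu q k *: (V q (x k) - V q y)| <= h * (d / 2).
  apply: (le_trans (ler_norm_sum _ _ _)).
  rewrite [leRHS]big_distrl /= big_nat [leRHS]big_nat; apply: ler_sum => k kbe.
  rewrite normrZ gtr0_norm // ler_pM2l //.
  apply: (le_trans (ler_norm_sum _ _ _)).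
  apply: (@le_trans _ _ (\sum_(q : Q) (`|C| * M) * (d / (2 * (P + 1))))).
    apply: ler_sum => q _; rewrite normrZ -mulrA; apply: ler_pM => //.
      have /andP[m0 mC] := mu_bound q k.
      by rewrite ger0_norm // (le_trans mC) // ler_norm.
    apply: (le_trans (V_lip _ _ _)); apply: ler_wpM2l => //; exact: near1.
  rewrite sumr_const; rewrite [leLHS](_ : _ = P * (d / (2 * (P + 1)))); last first.
    by rewrite /P -[LHS]mulr_natl !mulrA.
  rewrite (_ : d / (2 * (P + 1)) = d / 2 / (P + 1)); last by field; rewrite gt_eqF.
  rewrite mulrCA ger_pMr ?divr_gt0 // ler_pdivrMr //; lra.
have lb : h * (d / 2) <= `|x e - x b|.
  have := Hd w w0C wact w1; rewrite -(ler_pM2l h0) => H1.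
  rewrite DE -opprD normrN.
  have := lerB_dist (h *: \sum_q w q *: V q y)
    (- \sum_(b <= k < e) alpha k *: \sum_q mu q k *: (V q (x k) - V q y)).
  rewrite opprK normrN normrZ gtr0_norm //; lra.
apply: le_trans (norm_le_sqnorm _).
have -> : d ^+ 2 / 4 * h ^+ 2 = (h * (d / 2)) ^+ 2 by field.
by rewrite lerXn2r // nnegrE // mulr_ge0 // ltW // divr_gt0.
Qed.

End Nondegenerate.

(** * Continuous selections of finitely many affine functions *)

Section PiecewiseAffine.
Context {R : realType} {n : nat}.

(** The direction is taken on the moment curve [(1, s, s^2, ...)]: pairing [w j] with it evaluates
    at [s] the polynomial with coefficients [w j], and the product of the nonzero ones has finitely
    many roots. *)
Lemma generic_direction (J : finType) (w : J -> 'rV[R]_n) :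
  exists v, forall j, w j != 0 -> dot (w j) v != 0.
Proof.
pose P := \prod_(j | w j != 0) rVpoly (w j).
have P0 : P != 0.
  apply/prodf_neq0 => j; apply: contraNneq => w0.
  by rewrite -(rVpolyK (w j)) w0 linear0.
have [s Ps] : exists s, ~~ root P s.
  have /allPn[s _ Ps] : ~~ all (root P) [seq i%:R | i <- iota 0 (size P)].
    apply/negP => /(max_poly_roots P0).
    rewrite map_inj_uniq ?iota_uniq => [/(_ isT)|]; last exact: mulrIn (oner_neq0 _).
    by rewrite size_map size_iota ltnn.
  by exists s.
exists (\row_i s ^+ i) => j wj; apply: contraNneq Ps => d0.
rewrite /P (bigD1 j) //= rootM; apply/orP; left; rewrite rootE -d0 horner_poly.
by apply/eqP/eq_bigr => i _; rewrite valK mxE.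
Qed.

Variables (J : finType) (g : J -> 'rV[R]_n) (b : J -> R).

Definition affine_piece (j : J) (y : 'rV[R]_n) : R := dot (g j) y + b j.

Lemma affine_pieceD j y v (t : R) :
  affine_piece j (y + t *: v) = affine_piece j y + t * dot (g j) v.
Proof. by rewrite /affine_piece dotDr dotZr; ring. Qed.

(** Along the segment, let [s] be the last time at which the average slope from 0 is at most [M],
    for some [M > L * |v|]. Just after [s] the function grows faster than [M], yet it must agree
    with some piece: pieces meeting it at [s] grow too slowly, and the others stay away by
    continuity. *)
Lemma piecewise_affine_lip (K : set 'rV[R]_n) (f : 'rV[R]_n -> R) (L : R) :
  (forall y z (t : R), K y -> K z -> 0 <= t <= 1 -> K (y + t *: (z - y))) ->
  (forall y (e : R), K y -> 0 < e -> \forall z \near y, K z -> `|f y - f z| < e) ->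
  (forall y, K y -> exists j, f y = affine_piece j y) ->
  0 <= L -> (forall j v, dot (g j) v <= L * `|v|) ->
  forall y z, K y -> K z -> f z - f y <= L * `|z - y|.
Proof.
move=> Kc fc fsel L0 gL y z Ky Kz; rewrite leNgt; apply/negP => gap.
set v : 'rV[R]_n := z - y in gap *.
pose h (t : R) := f (y + t *: v).
have Kt (t : R) : 0 <= t <= 1 -> K (y + t *: v) by exact: Kc.
have [M [mM Mh M0]] : exists M, [/\ L * `|v| < M, M < h 1 - h 0 & 0 <= M].
  have [m1 m2] := midf_lt gap; exists ((L * `|v| + (f z - f y)) / 2).
  rewrite /h scale1r scale0r addr0 (_ : y + v = z); last by rewrite addrC subrK.
  split=> //.
  by apply/ltW/(le_lt_trans _ m1); rewrite mulr_ge0.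
have hc (s e : R) : 0 <= s <= 1 -> 0 < e ->
    \forall t \near s, 0 <= t <= 1 -> `|h s - h t| < e.
  move=> s01 e0; have H := fc _ e (Kt s s01) e0.
  have pc : (fun t : R => y + t *: v) @ s --> y + s *: v.
    by apply: cvgD; [exact: cvg_cst|apply: cvgZr_tmp; exact: cvg_id].
  have {}H := pc _ H; near=> t => /Kt; rewrite /h; near: t; exact: H.
pose S := [set t : R | 0 <= t <= 1 /\ h t - h 0 <= M * t].
have S0 : S 0 by split; rewrite ?lexx ?ler01 // subrr mulr0.
have Sub : ubound S 1 by move=> t [/andP[]].
have hS : has_sup S by split; [exists 0|exists 1].
pose s := sup S.
have s01 : 0 <= s <= 1.
  by apply/andP; split; [apply: ub_le_sup => //; exists 1|apply: ge_sup => //; exists 0].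
have hs : h s - h 0 <= M * s.
  apply/ler_addgt0Pr => e e0.
  have /nbhs_ballP[d /= d0 Hd] := hc s e s01 e0.
  have [t [t01 ht] st] := sup_adherent d0 hS.
  have ts : t <= s by apply: ub_le_sup => //; exists 1.
  have : `|h s - h t| < e.
    by apply: Hd => //; rewrite -ball_normE /= ger0_norm ?subr_ge0 // ltrBlDr -ltrBlDl.
  have : M * t <= M * s by rewrite ler_wpM2l.
  rewrite ltr_norml => ? /andP[_]; lra.
have s1 : s < 1.
  have [_ s1] := andP s01; rewrite lt_neqAle s1 andbT; apply/eqP => E.
  by move: hs; rewrite E mulr1 leNgt Mh.
have hgt (t : R) : s < t -> t <= 1 -> M * (t - s) < h t - h s.
  move=> st t1; have : h t - h 0 > M * t.
    rewrite ltNge; apply/negP => ht; have := st; rewrite ltNge => /negP; apply.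
    apply: ub_le_sup; first by exists 1.
    by split=> //; rewrite t1 andbT (le_trans _ (ltW st)) //; case/andP: s01.
  rewrite mulrBr; lra.
pose lj j (t : R) := affine_piece j (y + t *: v).
have ljE j (t : R) : lj j t - lj j s = (t - s) * dot (g j) v.
  by rewrite /lj !affine_pieceD; ring.
have lnear j : \forall t \near s, s < t -> t <= 1 -> h t <> lj j t.
  have [hj|hj] := eqVneq (h s) (lj j s).
    near=> t => st t1 E; have := hgt t st t1; rewrite E hj ljE mulrC ltr_pM2l ?subr_gt0 //.
    by rewrite ltNge (le_trans (gL j v)) // ltW.
  pose e := `|h s - lj j s|.
  have e0 : 0 < e by rewrite normr_gt0 subr_eq0.
  have /(_ s) lc : continuous (lj j).
    move=> t; rewrite /lj (_ : (fun _ => _) = fun t => affine_piece j y + t * dot (g j) v).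
      by apply: cvgD; [exact: cvg_cst|apply: cvgM; [exact: cvg_id|exact: cvg_cst]].
    by apply/funext => t'; rewrite affine_pieceD.
  have e2 : 0 < e / 2 by rewrite divr_gt0.
  have /cvgrPdist_lt/(_ _ e2) ljnear := lc; have hnear := hc s _ s01 e2.
  near=> t => st t1 E.
  have t01 : 0 <= t <= 1 by rewrite t1 andbT (le_trans _ (ltW st)) //; case/andP: s01.
  have H1 : `|h s - h t| < e / 2 by apply: (near hnear t) => //.
  have H2 : `|lj j s - lj j t| < e / 2 by near: t.
  have : e < e / 2 + e / 2; last by lra.
  rewrite {1}/e (_ : h s - lj j s = (h s - h t) - (lj j s - lj j t)); last by rewrite E; ring.
  by apply: (le_lt_trans (ler_normB _ _)); exact: ltrD.
have /nbhs_ballP[e /= e0 He] : \forall t \near s, forall j, s < t -> t <= 1 -> h t <> lj j t.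
  exact: filter_forall lnear.
pose t := s + Num.min (e / 2) (1 - s).
have m0 : 0 < Num.min (e / 2) (1 - s) by rewrite lt_min divr_gt0 ?subr_gt0.
have st : s < t by rewrite ltrDl.
have t1 : t <= 1.
  have : Num.min (e / 2) (1 - s) <= 1 - s by rewrite ge_min lexx orbT.
  by rewrite /t; lra.
have tb : ball s e t.
  have : Num.min (e / 2) (1 - s) <= e / 2 by rewrite ge_min lexx.
  by rewrite -ball_normE /= /t opprD addNKr normrN gtr0_norm //; lra.
have [|j hj] := fsel (y + t *: v).
  by apply: Kt; rewrite t1 andbT (le_trans _ (ltW st)) //; case/andP: s01.
by have := He t tb j st t1; apply.
Unshelve. all: by end_near.
Qed.

End PiecewiseAffine.

(** * Gradients and finite convex combinations *)

Section Gradient.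
Context {R : realType} {n : nat}.

Lemma derive_gradient (h : 'rV[R]_n -> R) (u v : 'rV[R]_n) :
  differentiable h u -> 'D_v h u = dot (gradient h u) v.
Proof.
move=> dh; rewrite deriveE // {1}(row_sum_delta v) linear_sum /=.
by apply: eq_bigr => i _; rewrite linearZ mxE deriveE // mulrC.
Qed.

Lemma convex_setE (A : set 'rV[R]_n) :
  convex_set A <-> forall u v (t : R), A u -> A v -> 0 <= t <= 1 ->
    A (t *: u + (1 - t) *: v).
Proof.
split=> H.
  move=> u v t Au Av /andP[t0 t1]; have := H u v (Itv01 t0 t1).
  by rewrite !inE; apply.
move=> u v t; rewrite !inE => Au Av; apply: H => //.
by rewrite ge0 le1.
Qed.

Lemma convex_combination (A : set 'rV[R]_n) (J : finType) (lam : J -> R)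
    (v : J -> 'rV[R]_n) :
  convex_set A -> (forall j, 0 <= lam j) -> (forall j, lam j != 0 -> A (v j)) ->
  \sum_j lam j = 1 -> A (\sum_j lam j *: v j).
Proof.
move=> /convex_setE cA lam0 Av lam1.
(* Partial sums are renormalized to remain in [A]; the first alternative is zero mass, where this is
   impossible. *)
have H (s : seq J) : (\sum_(j <- s) lam j = 0 /\ \sum_(j <- s) lam j *: v j = 0) \/
    (0 < \sum_(j <- s) lam j /\
     A ((\sum_(j <- s) lam j)^-1 *: \sum_(j <- s) lam j *: v j)).
  elim: s => [|j s IH]; first by left; rewrite !big_nil.
  rewrite !big_cons; have [->|lj] := eqVneq (lam j) 0.
    by rewrite scale0r !add0r.
  have lj0 : 0 < lam j by rewrite lt_neqAle eq_sym lj lam0.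
  right; case: IH => [[-> ->]|[c0 Ac]].
    by rewrite !addr0 scalerA mulVf // scale1r; split=> //; exact: Av.
  set c := \sum_(i <- s) lam i in c0 Ac *; set w := \sum_(i <- s) _ in Ac *.
  have lc : 0 < lam j + c by rewrite addr_gt0.
  split=> //; have := cA _ _ (lam j / (lam j + c)) (Av j lj) Ac.
  rewrite divr_ge0 ?(ltW lj0) ?(ltW lc) //= ler_pdivrMr // mul1r lerDl (ltW c0) => /(_ isT).
  rewrite scalerA (_ : (1 - _) * _ = (lam j + c)^-1); last by field; rewrite !gt_eqF.
  by rewrite [lam j / _]mulrC -scalerA -scalerDr.
have := H (index_enum J); rewrite lam1 => -[[/eqP]|[_]]; first by rewrite oner_eq0.
by rewrite invr1 scale1r.
Qed.

End Gradient.

(** * The Clarke gradient of a quadratic plus a continuous selection of affine functions *)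

Section QuadraticPiecewise.
Context {R : realType} {n : nat}.
Variables (J : finType) (g : J -> 'rV[R]_n) (b : J -> R).
Variables (K : set 'rV[R]_n) (f : 'rV[R]_n -> R) (x0 : 'rV[R]_n) (a : R).
Hypothesis a0 : 0 < a.
Hypothesis f_sel : forall y, K y -> exists j, f y = affine_piece g b j y.
Hypothesis f_cont : forall y (e : R), K y -> 0 < e ->
  \forall z \near y, K z -> `|f y - f z| < e.

Definition penalty (y : 'rV[R]_n) : R := sqnorm (y - x0) + a * f y.
Definition piece_grad (j : J) (y : 'rV[R]_n) : 'rV[R]_n := 2 *: (y - x0) + a *: g j.

Let piece j (y : 'rV[R]_n) : R := sqnorm (y - x0) + a * affine_piece g b j y.

Let pieceD j (u v : 'rV[R]_n) (t : R) :
  piece j (t *: v + u) = piece j u + t * dot (piece_grad j u) v + t ^+ 2 * sqnorm v.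
Proof.
rewrite /piece /piece_grad [t *: v + u]addrC affine_pieceD [u + t *: v - x0]addrAC (sqnormD (u - x0)) sqnormZ.
by rewrite dotZr (dotDl (2 *: _)) !dotZl; ring.
Qed.

(** Along a direction [v] that distinguishes the gradient from every different piece gradient,
    [penalty] meets some piece at each small [t]. A piece inactive at [u] is avoided by continuity,
    an active one with another gradient by its directional derivative, so one active piece has the
    right gradient. *)
Lemma gradient_penalty u : K° u -> differentiable penalty u ->
  exists j, f u = affine_piece g b j u /\ gradient penalty u = piece_grad j u.
Proof.
move=> Ku dF; pose D := gradient penalty u.
have [v Hv] := generic_direction (fun j => D - piece_grad j u).
have quot : (fun t : R => t^-1 * (penalty (t *: v + u) - penalty u)) @ 0^' --> dot D v.
  by rewrite -derive_gradient //; exact: (diff_derivable dF).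
have id0 : (fun t : R => t) @ 0^' --> (0 : R).
  exact: cvg_within.
have rem j : (fun t : R => dot (piece_grad j u) v + t * sqnorm v) @ 0^'
    --> dot (piece_grad j u) v.
  have : (fun t : R => dot (piece_grad j u) v + t * sqnorm v) @ 0^'
      --> dot (piece_grad j u) v + 0 * sqnorm v.
    by apply: cvgD; [exact: cvg_cst|apply: cvgMr_tmp; exact: id0].
  by rewrite mul0r addr0.
apply: contrapT => nex.
have bad j : \forall t \near 0^', penalty (t *: v + u) <> piece j (t *: v + u).
  have [fE|fN] := eqVneq (f u) (affine_piece g b j u).
    have /Hv : D - piece_grad j u != 0.
      by apply: contra_notN nex => /eqP/subr0_eq E; exists j.
    rewrite dotBl -normr_gt0 => d0.
    have /cvgrPdist_lt/(_ _ d0) H : (fun t : R => t^-1 * (penalty (t *: v + u) - penalty u)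
        - (dot (piece_grad j u) v + t * sqnorm v)) @ 0^' --> dot D v - dot (piece_grad j u) v.
      by apply: cvgB; [exact: quot|exact: rem].
    near=> t => E.
    have t0 : t != 0 by near: t; exact: nbhs_dnbhs_neq.
    have : `|dot D v - dot (piece_grad j u) v - (t^-1 * (penalty (t *: v + u) - penalty u)
        - (dot (piece_grad j u) v + t * sqnorm v))| < `|dot D v - dot (piece_grad j u) v|.
      by near: t.
    rewrite E pieceD /penalty fE -/(piece j u).
    rewrite (_ : t^-1 * _ - _ = 0) ?subr0 ?ltxx //.
    by field.
  pose d := penalty u - piece j u.
  have d0 : 0 < `|d|.
    rewrite normr_gt0 (_ : d = a * (f u - affine_piece g b j u)).
      by apply: mulf_neq0; [exact: lt0r_neq0|rewrite subr_eq0].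
    by rewrite /d /penalty /piece; ring.
  (* The function is [penalty] minus the piece at [t *: v + u], written through the difference
     quotient so that its limit [d] can be read off. *)
  have /cvgrPdist_lt/(_ _ d0) H : (fun t : R => d +
      t * (t^-1 * (penalty (t *: v + u) - penalty u)
        - (dot (piece_grad j u) v + t * sqnorm v))) @ 0^' --> d.
    have : (fun t : R => d + t * (t^-1 * (penalty (t *: v + u) - penalty u)
        - (dot (piece_grad j u) v + t * sqnorm v))) @ 0^'
        --> d + 0 * (dot D v - dot (piece_grad j u) v).
      apply: cvgD; first exact: cvg_cst.
      by apply: cvgM; [exact: id0|apply: cvgB; [exact: quot|exact: rem]].
    by rewrite mul0r addr0.
  near=> t => E.
  have t0 : t != 0 by near: t; exact: nbhs_dnbhs_neq.
  have : `|d - (d + t * (t^-1 * (penalty (t *: v + u) - penalty u)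
        - (dot (piece_grad j u) v + t * sqnorm v)))| < `|d| by near: t.
  rewrite E pieceD (_ : d - (d + _) = d) ?ltxx // /d.
  by field.
have inK : \forall t \near 0^', K (t *: v + u).
  apply: nbhs_dnbhs.
  have c : (fun t : R => t *: v + u) @ (0 : R) --> 0 *: v + u.
    by apply: cvgD; [apply: cvgZr_tmp; exact: cvg_id|exact: cvg_cst].
  by rewrite scale0r add0r in c; exact: c.
have allbad : \forall t \near 0^', forall j, penalty (t *: v + u) <> piece j (t *: v + u).
  exact: filter_forall bad.
have [t [Kt Bt]] := filter_ex (filterI inK allbad).
by have [j fE] := f_sel Kt; apply: (Bt j); rewrite /penalty fE.
Unshelve. all: by end_near.
Qed.

(** Activity at [x] alone would be too weak: these are the indices whose gradients at [x] are limits
    of gradients of [penalty], and they generate the Clarke gradient. *)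
Definition essential (x : 'rV[R]_n) (j : J) : Prop := forall e : R, 0 < e ->
  exists u, [/\ K° u, `|x - u| < e, differentiable penalty u,
    f u = affine_piece g b j u & gradient penalty u = piece_grad j u].

Lemma essential_active x j : K x -> essential x j -> f x = affine_piece g b j x.
Proof.
move=> Kx ess; apply/eqP; rewrite -subr_eq0 -normr_le0; apply/ler_addgt0Pr => e e0.
rewrite add0r.
have e2 : 0 < e / 2 by rewrite divr_gt0.
have ne : 0 < e / (2 * (n%:R * `|g j| + 1)).
  by rewrite divr_gt0 // mulr_gt0 // ltr_wpDl // mulr_ge0.
have /nbhs_ballP[d /= d0 Hd] := f_cont Kx e2.
have [|u [Ku xu _ fu _]] := ess (Num.min d (e / (2 * (n%:R * `|g j| + 1)))).
  by rewrite lt_min d0.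
move: xu; rewrite lt_min => /andP[xd xe].
have H1 : `|f x - f u| < e / 2 by apply: Hd; [rewrite -ball_normE|exact: interior_subset].
have H2 : `|affine_piece g b j u - affine_piece g b j x| <= e / 2.
  rewrite /affine_piece [X in `|X|](_ : _ = dot (g j) (u - x)); last by rewrite dotBr; ring.
  apply: (le_trans (dot_le_norm _ _)); rewrite distrC mulrA.
  move: xe; rewrite ltr_pdivlMr ?mulr_gt0 ?ltr_wpDl // ?mulr_ge0 //.
  have := normr_ge0 (x - u); set X := `|x - u|; set Y := n%:R * _; lra.
rewrite (_ : f x - _ = (f x - f u) + (affine_piece g b j u - affine_piece g b j x)).
  by apply: (le_trans (ler_normD _ _)); lra.
by rewrite fu; ring.
Qed.

(** Failure to be essential at [x] with radius [e] excludes being essential at points closer than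
    [e / 2]; finitely many indices share one radius. *)
Lemma essential_near x : exists2 r : R, 0 < r &
  forall y j, `|y - x| <= r -> essential y j -> essential x j.
Proof.
have H j : \forall r \near (0 : R)^'+, forall y, `|y - x| <= r -> essential y j -> essential x j.
  have [ess|/existsNP[e /not_implyP[e0 ness]]] := pselect (essential x j).
    by near=> r.
  near=> r => y xy ess; exfalso; apply: ness.
  have r0 : 0 < r by [].
  have re : r < e / 2 by near: r; apply: nbhs_right_lt; rewrite divr_gt0.
  have [u [Ku yu du fu gu]] := ess _ r0; exists u; split=> //.
  rewrite -(subrKA y); apply: (le_lt_trans (ler_normD _ _)).
  rewrite distrC; lra.
have /filter_ex[r [r0 Hr]] : \forall r \near (0 : R)^'+, 0 < r /\
    forall j y, `|y - x| <= r -> essential y j -> essential x j.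
  by apply: filterI; [exact: nbhs_right_gt|exact: filter_forall H].
by exists r => // y j; exact: Hr.
Unshelve. all: by end_near.
Qed.

(** The right-hand combinations form a convex set, so it suffices to place limiting gradients in it:
    by [gradient_penalty] each term of the sequence is a piece gradient, and one piece recurs
    infinitely often. Conversely, an essential index supplies an approximating sequence. *)
Lemma clarke_penalty x v : clarke_gradient K penalty x v <->
  exists lam : J -> R, [/\ forall j, 0 <= lam j, forall j, lam j != 0 -> essential x j,
    \sum_j lam j = 1 & v = \sum_j lam j *: piece_grad j x].
Proof.
split; last first.
  move=> [lam [l0 less l1 ->]].
  move=> A [cA HA]; apply: convex_combination => // j /less ess; apply: HA.
  have /choice[u Hu] : forall i : nat, exists u, [/\ K° u, `|x - u| < i.+1%:R^-1,
      differentiable penalty u, f u = affine_piece g b j u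
      & gradient penalty u = piece_grad j u].
    by move=> i; apply: ess; rewrite invr_gt0.
  have ux : u @ \oo --> x.
    apply/cvgrPdist_lt => e e0; near=> i.
    have [_ xu _ _ _] := Hu i; apply: (lt_trans xu).
    by near: i; exact: near_infty_natSinv_lt (PosNum e0).
  exists u; split=> //; first by move=> i; have [? _ ? _ _] := Hu i.
  rewrite (_ : (fun i => _) = fun i => piece_grad j (u i)); last first.
    by apply/funext => i; have [_ _ _ _] := Hu i.
  apply: cvgD; last exact: cvg_cst.
  by apply: cvgZl_tmp; apply: cvgB => //; exact: cvg_cst.
move: v; apply: smallest_sub.
  apply/convex_setE => u v t [l [l0 le l1 ->]] [m [m0 me m1 ->]] /andP[t0 t1].
  exists (fun j => t * l j + (1 - t) * m j); split.
  - by move=> j; rewrite addr_ge0 // mulr_ge0 // subr_ge0.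
  - move=> j; have [->|/le//] := eqVneq (l j) 0.
    by have [->|/me//] := eqVneq (m j) 0; rewrite !mulr0 addr0 eqxx.
  - by rewrite big_split /= -!big_distrr /= l1 m1; ring.
  - rewrite !scaler_sumr -big_split /=; apply: eq_bigr => j _.
    by rewrite !scalerA -scalerDl.
move=> v [u [Ku ux gv]].
have /choice[s Hs] : forall i, exists j, f (u i) = affine_piece g b j (u i) /\
    gradient penalty (u i) = piece_grad j (u i).
  by move=> i; have [Ki di] := Ku i; exact: gradient_penalty.
(* Pigeonhole: otherwise every index would stop occurring after some time, and so would all of them
   after the maximum of these times. *)
have [j Hj] : exists j, forall N, exists2 i, (N <= i)%N & s i = j.
  apply: contrapT => /forallNP nj.
  have /choice[N HN] : forall j, exists N, forall i, (N <= i)%N -> s i <> j.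
    move=> j; have /existsNP[N HN] := nj j.
    by exists N => i Ni sj; apply: HN; exists i.
  pose m := \max_j N j.
  by apply: (HN (s m) m) => //; exact: leq_bigmax.
exists (fun i => (i == j)%:R); split.
- by move=> i; rewrite ler0n.
- move=> i; have [-> _|] := eqVneq i j; last by rewrite eqxx.
  move=> e e0; have /cvgrPdist_lt/(_ _ e0)[N _ HN] := ux.
  have [k Nk sk] := Hj N; exists (u k); have [Kk dk] := Ku k.
  by have [fk gk] := Hs k; rewrite sk in fk gk; split=> //; exact: HN.
- rewrite (bigD1 j) //= big1 ?addr0 ?eqxx // => i ij; by rewrite (negPf ij).
- rewrite (bigD1 j) //= big1 ?addr0 ?eqxx ?scale1r; last first.
    by move=> i ij; rewrite (negPf ij) scale0r.
  have pc : (fun i => piece_grad j (u i)) @ \oo --> piece_grad j x.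
    apply: cvgD; last exact: cvg_cst.
    by apply: cvgZl_tmp; apply: cvgB => //; exact: cvg_cst.
  apply/eqP; rewrite -subr_eq0 -normr_le0; apply/ler_addgt0Pr => e e0; rewrite add0r.
  have e2 : 0 < e / 2 by rewrite divr_gt0.
  have /cvgrPdist_lt/(_ _ e2)[N1 _ H1] := gv.
  have /cvgrPdist_lt/(_ _ e2)[N2 _ H2] := pc.
  have [k] := Hj (maxn N1 N2); rewrite geq_max => /andP[k1 k2] sk.
  have [_ gk] := Hs k; rewrite sk in gk.
  have := H1 k k1; have := H2 k k2; rewrite /= gk => A1 A2.
  rewrite -(subrKA (piece_grad j (u k))); apply: (le_trans (ler_normD _ _)).
  rewrite [X in _ + X]distrC; lra.
Unshelve. all: by end_near.
Qed.

End QuadraticPiecewise.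

(** * The faces of the cube and the orthogonal projection onto it *)

Section CubeProjection.
Context {R : realType} {n : nat}.
Implicit Types (x y z : 'rV[R]_n) (q : 'I_n * bool).

(* The faces of the cube are indexed by [(i, s)]: [x_i = 1] if [s], and [x_i = 0] otherwise. *)
Definition face_slack q y : R := if q.2 then 1 - y 0 q.1 else y 0 q.1.
Definition face_normal q : 'rV[R]_n := (if q.2 then 1 else -1) *: delta_mx 0 q.1.
(** This is the multiplier of [face_normal q] in the projection of [y] onto the cube. *)
Definition overshoot q y : R := Num.max 0 (- face_slack q y).

Lemma dot_face_normal q z y : dot (face_normal q) (z - y) = face_slack q y - face_slack q z.
Proof.
case: q => i s; rewrite /face_normal /face_slack dotZl dot_delta /= !mxE.
by case: s; ring.
Qed.

Lemma face_slackB_le q y z : `|face_slack q y - face_slack q z| <= `|y - z|.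
Proof.
apply: le_trans (coord_le_norm (y - z) q.1); rewrite /face_slack !mxE.
by case: q.2; rewrite // [X in `|X| <= _](_ : _ = - (y 0 q.1 - z 0 q.1)) ?normrN //; ring.
Qed.

Lemma face_slack_ge0 q y : unit_cube y -> 0 <= face_slack q y.
Proof. by move=> /(_ q.1)/andP[y0 y1]; rewrite /face_slack; case: q.2; rewrite ?subr_ge0. Qed.

Lemma face_sum_coord (w : 'I_n * bool -> R) i :
  (\sum_q w q *: face_normal q) 0 i = w (i, true) - w (i, false).
Proof.
rewrite (eq_bigr (fun p => w (p.1, p.2) *: face_normal (p.1, p.2))); last by case.
rewrite -(pair_bigA _ (fun i s => w (i, s) *: face_normal (i, s))) /=.
rewrite summxE (bigD1 i) //= [X in _ + X]big1 => [|j ji].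
  by rewrite big_bool /face_normal /= !mxE !eqxx /=; ring.
by rewrite big_bool /face_normal /= !mxE !eqxx eq_sym (negPf ji) /=; ring.
Qed.

(** The projection is the coordinatewise clamp [c]. *)
Lemma orth_proj_cube y : let p := orth_proj unit_cube y in
  unit_cube p /\ p = y - \sum_q overshoot q y *: face_normal q.
Proof.
pose c : 'rV[R]_n := \row_i Num.max 0 (Num.min 1 (y 0 i)).
have cK : unit_cube c.
  move=> i; rewrite mxE; have [m1|m1] := leP 1 (y 0 i).
    by rewrite max_r ?ler01 ?lexx.
  by have [m0|m0] := leP 0 (y 0 i); rewrite ?lexx ?ler01 ?m0 ?(ltW m1).
have cE : c = y - \sum_q overshoot q y *: face_normal q.
  apply/rowP => i; rewrite mxE [in RHS]mxE [X in _ = _ + X]mxE face_sum_coord.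
  rewrite /overshoot /face_slack /=.
  have [m1|m1] := leP 1 (y 0 i); have [m0|m0] := leP 0 (y 0 i);
    rewrite /Num.max; do ! case: ifPn; rewrite -?leNgt; lra.
(* The obtuse angle inequality; it shows both that [c] is a minimizer and that every minimizer
   equals [c]. *)
have cB z : unit_cube z -> sqnorm (y - c) + sqnorm (z - c) <= sqnorm (y - z).
  move=> zK; rewrite /sqnorm /dot -big_split; apply: ler_sum => i _ /=.
  rewrite !mxE; have /andP[z0 z1] := zK i.
  have [m1|m1] := leP 1 (y 0 i).
    by rewrite max_r ?ler01 //; nra.
  by have [m0|m0] := leP 0 (y 0 i); nra.
have ex : exists p, unit_cube p /\ forall z, unit_cube z -> sqnorm (y - p) <= sqnorm (y - z).
  exists c; split=> // z /cB; have := sqnorm_ge0 (z - c); lra.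
have [pK pmin] : unit_cube (orth_proj unit_cube y) /\ _ := getPex ex; rewrite /=.
split=> //; rewrite -cE; apply: subr0_eq; apply: sqnorm_eq0.
apply/eqP; rewrite eq_le sqnorm_ge0 andbT.
have := cB _ pK; have := pmin c cK; rewrite /orth_proj; lra.
Qed.

Lemma overshoot_le q y x : unit_cube x -> 0 <= overshoot q y <= `|y - x|.
Proof.
move=> xK; rewrite /overshoot le_max lexx /= ge_max normr_ge0 /=.
apply: le_trans (face_slackB_le q y x); have := face_slack_ge0 q xK.
by rewrite -[`|_ - _|]normrN; have := ler_norm (- (face_slack q y - face_slack q x)); lra.
Qed.

(** A face that pushes back on a step is within the step length of its starting point. *)
Lemma overshoot_slack q y x : unit_cube x -> overshoot q y != 0 ->
  `|face_slack q x| <= `|y - x|.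
Proof.
move=> xK; rewrite ger0_norm ?face_slack_ge0 // => o0.
apply: le_trans (face_slackB_le q y x).
have : face_slack q y < 0.
  by rewrite ltNge; apply: contraNN o0 => s0; rewrite /overshoot max_l ?oppr_le0.
by rewrite -[`|_ - _|]normrN; have := ler_norm (- (face_slack q y - face_slack q x)); lra.
Qed.

Lemma orth_proj_cube_dist y x : unit_cube x ->
  `|orth_proj unit_cube y - x| <= `|y - x|.
Proof.
move=> xK; have [pK pE] := orth_proj_cube y.
apply: norm_le_coord => // i; apply: le_trans (coord_le_norm (y - x) i).
have := congr1 (fun w : 'rV[R]_n => w 0 i) pE.
rewrite [in RHS]mxE [X in _ = _ + X]mxE face_sum_coord /overshoot /face_slack /= => pi.
rewrite !mxE pi.
have /andP[x0 x1] := xK i.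
rewrite /Num.max; do ! case: ifPn; rewrite -?leNgt => h1 h2;
  rewrite ler_norml; apply/andP; split; have := ler_norm (y 0 i - x 0 i);
  have := lerNnormlW (lexx `|y 0 i - x 0 i|); lra.
Qed.

Lemma unit_cube_compact : compact (@unit_cube R n).
Proof.
rewrite (_ : unit_cube = [set v : 'rV[R]_n | forall i, `[0, 1]%classic (v 0 i)]).
  by apply: (@rV_compact R^o n (fun=> `[0, 1]%classic)) => i; exact: segment_compact.
by apply/seteqP; split=> v /= H i; have := H i; rewrite in_itv.
Qed.

Lemma unit_cube_dist y z : unit_cube y -> unit_cube z -> `|y - z| <= 1.
Proof.
move=> yK zK; apply: norm_le_coord => // i; rewrite !mxE ler_norml.
by have /andP[? ?] := yK i; have /andP[? ?] := zK i; apply/andP; split; lra.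
Qed.

Lemma unit_cube_segment y z (t : R) : unit_cube y -> unit_cube z -> 0 <= t <= 1 ->
  unit_cube (y + t *: (z - y)).
Proof.
move=> yK zK /andP[t0 t1] i; rewrite !mxE.
by have /andP[? ?] := yK i; have /andP[? ?] := zK i; apply/andP; split; nra.
Qed.

End CubeProjection.

(** * The projected subgradient method on the cube *)

Section CubePenalty.
Context {R : realType} {n : nat}.
Variables (J : finType) (g : J -> 'rV[R]_n) (b : J -> R).
Variables (f : 'rV[R]_n -> R) (x0 : 'rV[R]_n) (a L : R).
Hypothesis a0 : 0 < a.
Hypothesis L0 : 0 <= L.
Hypothesis x0K : unit_cube x0.
Hypothesis f_sel : forall y, unit_cube y -> exists j, f y = affine_piece g b j y.
Hypothesis f_lip : forall y z, unit_cube y -> unit_cube z -> `|f y - f z| <= L * `|y - z|.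

Let F := penalty f x0 a.
Let ess := essential g b unit_cube f x0 a.

Definition active_normal (q : J + 'I_n * bool) (y : 'rV[R]_n) : 'rV[R]_n :=
  match q with inl j => piece_grad g x0 a j y | inr q => face_normal q end.
Definition active_piece (y : 'rV[R]_n) : pred (J + 'I_n * bool) := fun q =>
  match q with
  | inl j => `[< essential g b unit_cube f x0 a y j >]
  | inr q => face_slack q y == 0
  end.
Definition piece_kind (q : J + 'I_n * bool) : R := if q is inl _ then 1 else 0.

Let crit : set 'rV[R]_n := balanced active_normal piece_kind active_piece.

Lemma penalty_base_cont (y : 'rV[R]_n) (e : R) : unit_cube y -> 0 < e ->
  \forall z \near y, unit_cube z -> `|f y - f z| < e.
Proof.
move=> yK e0; have L1 : 0 < L + 1 by rewrite ltr_wpDl.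
apply/nbhs_ballP; exists (e / (L + 1)) => /=; first by rewrite divr_gt0.
move=> z; rewrite -ball_normE /= ltr_pdivlMr // => yz zK.
by apply: (le_lt_trans (f_lip yK zK)); have := normr_ge0 (y - z); lra.
Qed.

Lemma penalty_piece_expansion j y z : unit_cube y -> ess y j -> unit_cube z -> ess z j ->
  F z = F y + dot (piece_grad g x0 a j y) (z - y) + sqnorm (z - y).
Proof.
move=> yK ey zK ez.
rewrite /F /penalty (essential_active penalty_base_cont yK ey) (essential_active penalty_base_cont zK ez).
rewrite (_ : z - x0 = (y - x0) + (z - y)); last by rewrite [RHS]addrC addrA subrK.
rewrite (sqnormD (y - x0)) /piece_grad (dotDl (2 *: _)) !dotZl /affine_piece dotBr.
by rewrite (dotBr z y (g j)); ring.
Qed.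

(** The face part of the balance equals minus the gradient part, and it lies in the normal cone
    because active faces have zero slack. *)
Lemma balanced_gradient y : unit_cube y -> crit y ->
  exists lam : J -> R, [/\ forall j, 0 <= lam j, forall j, lam j != 0 -> ess y j,
    \sum_j lam j = 1 &
    normal_cone unit_cube y (- \sum_j lam j *: piece_grad g x0 a j y)].
Proof.
move=> yK [w [w0 wact w1 ws]]; exists (fun j => w (inl j)); split=> //.
- by move=> j /wact/asboolP.
- move: w1; rewrite big_sumType /= [X in _ + X]big1 ?addr0 => [<-|q _]; last by rewrite mul0r.
  by apply: eq_bigr => j _; rewrite mul1r.
- move=> z zK; move: ws; rewrite big_sumType /= => /eqP; rewrite addrC addr_eq0 => /eqP <-.
  rewrite dot_suml; apply: sumr_le0 => q _; rewrite dotZl dot_face_normal.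
  have [->|/wact /= /eqP ->] := eqVneq (w (inr q)) 0; first by rewrite mul0r.
  by rewrite sub0r mulr_ge0_le0 // oppr_le0 face_slack_ge0.
Qed.

Lemma balanced_stationary y : unit_cube y -> crit y -> stationary_point unit_cube F y.
Proof.
move=> yK /(balanced_gradient yK)[lam [l0 less l1 ln]].
exists (\sum_j lam j *: piece_grad g x0 a j y), (- \sum_j lam j *: piece_grad g x0 a j y).
split=> //; last by rewrite subrr.
by apply/(clarke_penalty x0 a0 f_sel); exists lam.
Qed.

(* On a fixed set of essential pieces, [F] grows quadratically away from each
   critical point, so two critical points with the same set coincide. *)
Lemma critical_values_finite : finite_set (F @` (unit_cube `&` crit)).
Proof.
pose S (y : 'rV[R]_n) : {set J} := [set j | `[< ess y j >]]%SET.
have growth y z : unit_cube y -> crit y -> unit_cube z -> S y = S z ->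
    F y + sqnorm (z - y) <= F z.
  move=> yK yc zK yz; have [lam [l0 less l1 ln]] := balanced_gradient yK yc.
  have : F z = \sum_j lam j * (F y + dot (piece_grad g x0 a j y) (z - y) + sqnorm (z - y)).
    rewrite -[LHS]mul1r -l1 big_distrl /=; apply: eq_bigr => j _.
    have [->|/less ey] := eqVneq (lam j) 0; first by rewrite !mul0r.
    have ez : ess z j.
      by have : j \in S y by [rewrite inE; apply/asboolP]; rewrite yz inE => /asboolP.
    by rewrite -(penalty_piece_expansion yK ey zK ez).
  under eq_bigr do rewrite addrAC mulrDr.
  rewrite big_split /= -big_distrl /= l1 mul1r => ->; rewrite lerDl.
  rewrite [leRHS](_ : _ = dot (\sum_j lam j *: piece_grad g x0 a j y) (z - y)).
    by rewrite -oppr_le0 -dotNl; exact: ln.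
  by rewrite dot_suml; apply: eq_bigr => j _; rewrite dotZl.
(* The essential set determines the critical value; [x0] is a default for sets that no critical
   point has. *)
pose v (A : {set J}) := F (xget x0 [set y | [/\ unit_cube y, crit y & S y = A]]).
apply: (@sub_finite_set _ _ [set v A | A in setT]); last exact/finite_image/finite_finset.
move=> _ [y [yK yc] <-]; exists (S y) => //; rewrite /v.
have [zK zc zS] : [set z | [/\ unit_cube z, crit z & S z = S y]] (xget x0
    [set z | [/\ unit_cube z, crit z & S z = S y]]).
  by apply: xgetPex; exists y.
set z := xget _ _ in zK zc zS *.
have := growth y z yK yc zK (esym zS); have := growth z y zK zc yK zS.
by have := sqnorm_ge0 (y - z); have := sqnorm_ge0 (z - y); lra.
Qed.

Variables (alpha : nat -> R) (x G : nat -> 'rV[R]_n).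
Hypothesis alpha_gt0 : forall k, 0 < alpha k.
Hypothesis alpha_noninc : forall k, alpha k.+1 <= alpha k.
Hypothesis alpha_cvg0 : alpha @ \oo --> (0 : R).
Hypothesis alpha_div : series alpha @ \oo --> +oo.
Hypothesis x_start : x 0%N = x0.
Hypothesis G_clarke : forall k, clarke_gradient unit_cube F (x k) (G k).
Hypothesis x_step : forall k, x k.+1 = orth_proj unit_cube (x k - alpha k *: G k).

Lemma iterate_cube k : unit_cube (x k).
Proof.
case: k => [|k]; first by rewrite x_start.
by rewrite x_step; have [] := orth_proj_cube (x k - alpha k *: G k).
Qed.

Let g1 := \sum_j `|g j|.

Let g1_ge0 : 0 <= g1.
Proof. exact: sumr_ge0. Qed.

Let g1_ge j : `|g j| <= g1.
Proof. by rewrite /g1 (bigD1 j) //= lerDl; apply: sumr_ge0. Qed.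

Let Gam := 2 + a * g1.

Let Gam_ge0 : 0 <= Gam.
Proof. by rewrite addr_ge0 // mulr_ge0 // ltW. Qed.

Lemma subgradient_bound k : `|G k| <= 2 + a * \sum_j `|g j|.
Proof.
have /(clarke_penalty x0 a0 f_sel)[lam [l0 less l1 ->]] := @G_clarke k.
apply: (le_trans (ler_norm_sum _ _ _)).
rewrite -[leRHS]mul1r -l1 big_distrl /=; apply: ler_sum => j _.
rewrite normrZ ger0_norm //; apply: ler_wpM2l => //.
apply: (le_trans (ler_normD _ _)); rewrite !normrZ gtr0_norm // (gtr0_norm a0).
apply: lerD; last by rewrite ler_pM2l.
by have := unit_cube_dist (iterate_cube k) x0K; lra.
Qed.

Let step_bound k : `|x k - alpha k *: G k - x k| <= Gam * alpha k.
Proof.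
rewrite addrAC subrr add0r normrN normrZ gtr0_norm // mulrC.
by rewrite ler_pM2r // subgradient_bound.
Qed.

Lemma iterate_lip k : `|x k.+1 - x k| <= Gam * alpha k.
Proof.
by rewrite x_step; apply: (le_trans (orth_proj_cube_dist _ (iterate_cube k))).
Qed.

Lemma penalty_lip y z : unit_cube y -> unit_cube z ->
  `|F y - F z| <= (2 * n%:R + a * L) * `|y - z|.
Proof.
move=> yK zK.
have -> : F y - F z = dot (y - z) ((y - x0) + (z - x0)) + a * (f y - f z).
  rewrite /F /penalty (_ : y - x0 = (y - z) + (z - x0)); last by rewrite addrA subrK.
  move: (y - z) (z - x0) => u w.
  by rewrite sqnormD !(dotDr _ _ u) /sqnorm; ring.
apply: (le_trans (ler_normD _ _)); rewrite mulrDl; apply: lerD; last first.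
  by rewrite normrM gtr0_norm // -mulrA ler_pM2l // f_lip.
apply: (le_trans (dot_le_norm _ _)).
have -> : 2 * n%:R * `|y - z| = n%:R * (`|y - z| * 2) by ring.
do 2! apply: ler_wpM2l => //; apply: (le_trans (ler_normD _ _)).
by have := unit_cube_dist yK x0K; have := unit_cube_dist zK x0K; lra.
Qed.

(** For a piece, the quadratic terms of the objective and of the piece cancel in the gap. *)
Definition piece_gap (q : J + 'I_n * bool) (k : nat) : R :=
  match q with
  | inl j => a * (f (x k) - affine_piece g b j (x k))
  | inr q => face_slack q (x k)
  end.

Let CF := 2 * n%:R + a * L.
Let Cphi := a * (L + n%:R * g1) + 1.
(** One constant for all bounds of the energy argument: [CF] and [Cphi] are Lipschitz constants of
    the objective and of the gaps, [Gam] bounds the speed, and the last term serves [chain]. *)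
Let C := 1 + Gam + CF + CF * Gam + Cphi * Gam + 2 * n%:R * Gam ^+ 2.

Let CF_ge0 : 0 <= CF.
Proof. by rewrite addr_ge0 ?mulr_ge0 // ltW. Qed.

Let Cphi_ge1 : 1 <= Cphi.
Proof. by rewrite lerDr mulr_ge0 ?(ltW a0) // addr_ge0 // mulr_ge0. Qed.

Let C_bounds : [/\ 1 <= C, Gam <= C, CF <= C, CF * Gam <= C &
  Cphi * Gam <= C /\ 2 * n%:R * Gam ^+ 2 <= C].
Proof.
have h1 : 0 <= CF * Gam by exact: mulr_ge0.
have h2 : 0 <= Cphi * Gam by rewrite mulr_ge0 // (le_trans ler01).
have h3 : 0 <= 2 * n%:R * Gam ^+ 2 by rewrite !mulr_ge0 // exprn_ge0.
move: Gam_ge0 CF_ge0; rewrite /C.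
by move: (CF * Gam) (Cphi * Gam) (2 * n%:R * _) h1 h2 h3 => u v w *; do ?split; lra.
Qed.

(** The multipliers of pieces are the convex weights of [G k] in the Clarke gradient; those of faces
    are the overshoots of the projection divided by the step size. *)
Lemma step_decomposition : exists mu : J + 'I_n * bool -> nat -> R,
  [/\ forall k, x k.+1 - x k = - (alpha k *: \sum_q mu q k *: active_normal q (x k)),
      forall q k, 0 <= mu q k <= 1 + Gam,
      forall k, \sum_q piece_kind q * mu q k = 1,
      forall j k, mu (inl j) k != 0 -> ess (x k) j &
      forall q k, mu (inr q) k != 0 -> `|face_slack q (x k)| <= Gam * alpha k].
Proof.
have /choice[lam Hlam] : forall k, exists lam : J -> R,
    [/\ forall j, 0 <= lam j, forall j, lam j != 0 -> ess (x k) j,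
    \sum_j lam j = 1 & G k = \sum_j lam j *: piece_grad g x0 a j (x k)].
  by move=> k; apply/(clarke_penalty x0 a0 f_sel); exact: G_clarke.
pose y k := x k - alpha k *: G k.
pose mu (q : J + 'I_n * bool) k : R :=
  match q with inl j => lam k j | inr q => overshoot q (y k) / alpha k end.
exists mu; split.
- move=> k; have [l0 less l1 Gk] := Hlam k; rewrite big_sumType /= -Gk scalerDr.
  have [_ pE] := orth_proj_cube (y k); rewrite x_step pE /y opprD.
  rewrite addrAC [x k - _ - _]addrAC subrr add0r; congr (_ - _).
  rewrite scaler_sumr; apply: eq_bigr => q _.
  by rewrite scalerA mulrC divfK // lt0r_neq0.
- move=> [j|q] k; have [l0 less l1 Gk] := Hlam k; rewrite /mu.
    rewrite l0 /= -l1 (bigD1 j) //= -addrA lerDl addr_ge0 //.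
    by apply: sumr_ge0.
  have /andP[v0 o1] := overshoot_le q (y k) (iterate_cube k).
  rewrite divr_ge0 ?(ltW (alpha_gt0 k)) //= ler_pdivrMr // mulrDl mul1r.
  by have := step_bound k; have := alpha_gt0 k; rewrite -/(y k); lra.
- move=> k; have [l0 less l1 Gk] := Hlam k; rewrite big_sumType /= [X in _ + X]big1 ?addr0.
    by rewrite -[RHS]l1; apply: eq_bigr => j _; rewrite mul1r.
  by move=> q _; rewrite mul0r.
- by move=> j k; have [l0 less l1 Gk] := Hlam k; exact: less.
- move=> q k; rewrite mulf_eq0 negb_or => /andP[v0 _].
  exact: le_trans (overshoot_slack (iterate_cube k) v0) (step_bound k).
Qed.

(** Late steps near [y] use only indices active at [y]: essential pieces by [essential_near], and
    faces because a positive slack at [y] would stay larger than [Gam * alpha k]. *)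
Lemma iterate_nondegenerate mu :
  (forall k, x k.+1 - x k = - (alpha k *: \sum_q mu q k *: active_normal q (x k))) ->
  (forall q k, 0 <= mu q k <= 1 + Gam) ->
  (forall k, \sum_q piece_kind q * mu q k = 1) ->
  (forall j k, mu (inl j) k != 0 -> ess (x k) j) ->
  (forall q k, mu (inr q) k != 0 -> `|face_slack q (x k)| <= Gam * alpha k) ->
  forall y, unit_cube y -> ~ crit y -> exists (d r : R) N, [/\ 0 < d, 0 < r &
    forall b e, (N <= b < e)%N -> (forall i, (b <= i < e)%N -> `|x i - y| <= r) ->
    d * elapsed alpha b e ^+ 2 <= sqnorm (x e - x b)].
Proof.
move=> stepE mu_bound kappa_mu mu_ess mu_face y yK ncy.
have [r1 r10 near_ess] := essential_near g b unit_cube f x0 a y.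
have H q : \forall r \near (0 : R)^'+, forall k, Gam * alpha k < r -> `|x k - y| <= r ->
    mu q k != 0 -> active_piece y q.
  case: q => [j|q].
    near=> r => k _ xy /mu_ess ek; apply/asboolP; apply: near_ess ek.
    by apply: (le_trans xy); near: r; exact: nbhs_right_le.
  have [s0|s0] := eqVneq (face_slack q y) 0; first by near=> r => k _ _ _; rewrite /= s0.
  have sp : 0 < face_slack q y by rewrite lt_neqAle eq_sym s0 face_slack_ge0.
  near=> r => k ak xy /mu_face; rewrite (ger0_norm (face_slack_ge0 q (iterate_cube k))) => sk.
  have rs : r < face_slack q y / 2 by near: r; apply: nbhs_right_lt; rewrite divr_gt0.
  have := face_slackB_le q y (x k); rewrite [`|y - _|]distrC => /(le_trans (ler_norm _)) sy.
  by exfalso; lra.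
have /filter_ex[r' [r'0 Hr]] : \forall r' \near (0 : R)^'+, 0 < r' /\
    forall q k, Gam * alpha k < r' -> `|x k - y| <= r' -> mu q k != 0 -> active_piece y q.
  by apply: filterI; [exact: nbhs_right_gt|exact: filter_forall H].
have [|N HN] := alpha_small alpha_gt0 alpha_cvg0 (e := r' / (Gam + 1)).
  by rewrite divr_gt0 // ltr_wpDl.
have hyp k q : (N <= k)%N -> `|x k - y| <= r' -> mu q k != 0 -> active_piece y q.
  move=> /HN; rewrite ltr_pdivlMr ?ltr_wpDl // => ak; apply: Hr.
  by have := alpha_gt0 k; lra.
have V_lip q u v : `|active_normal q u - active_normal q v| <= 2 * `|u - v|.
  case: q => [j|q] /=; last by rewrite subrr normr0 mulr_ge0.
  rewrite /piece_grad opprD addrACA subrr addr0 -scalerBr normrZ gtr0_norm // ler_pM2l //.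
  by rewrite opprB addrA subrK.
exact: (nondegenerate alpha_gt0 (ler0n _ 2) V_lip stepE mu_bound kappa_mu r'0 hyp ncy).
Unshelve. all: by end_near.
Qed.

Lemma subgradient_cluster p : unit_cube p -> cluster (x @ \oo) p -> stationary_point unit_cube F p.
Proof.
move=> pK cp; apply: balanced_stationary => //.
have [mu [stepE mu_bound kappa_mu mu_ess mu_face]] := step_decomposition.
have [C1 CGam CCF CFGam [CphiGam CGam2]] := C_bounds.
have C0 : 0 < C by exact: lt_le_trans C1.
have lipC (c : R) k : c <= C -> c * alpha k <= C * alpha k by rewrite ler_pM2r.
have lipF k : `|F (x k.+1) - F (x k)| <= C * alpha k.
  apply: (le_trans (penalty_lip (iterate_cube k.+1) (iterate_cube k))).
  apply: (@le_trans _ _ (CF * Gam * alpha k)); last exact: lipC.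
  by rewrite -mulrA ler_wpM2l // iterate_lip.
have lipphi q k : `|piece_gap q k.+1 - piece_gap q k| <= C * alpha k.
  apply: (@le_trans _ _ (Cphi * `|x k.+1 - x k|)); last first.
    apply: (@le_trans _ _ (Cphi * Gam * alpha k)); last exact: lipC.
    by rewrite -mulrA ler_wpM2l ?iterate_lip // (le_trans ler01).
  case: q => [j|q] /=; last first.
    apply: (le_trans (face_slackB_le _ _ _)).
    by rewrite -[leLHS]mul1r ler_wpM2r.
  rewrite -mulrBr normrM gtr0_norm //.
  apply: (@le_trans _ _ (a * ((L + n%:R * g1) * `|x k.+1 - x k|))); last first.
    by rewrite mulrA ler_wpM2r // /Cphi lerDl.
  rewrite ler_pM2l //.
  have -> : f (x k.+1) - affine_piece g b j (x k.+1) - (f (x k) - affine_piece g b j (x k)) =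
      (f (x k.+1) - f (x k)) - dot (g j) (x k.+1 - x k).
    by rewrite /affine_piece dotBr; ring.
  apply: (le_trans (ler_normB _ _)); rewrite mulrDl; apply: lerD.
    by apply: f_lip; exact: iterate_cube.
  apply: (le_trans (dot_le_norm _ _)); rewrite -mulrA ler_wpM2l // ler_wpM2r //.
apply: (cluster_crit (C := C) alpha_gt0 alpha_noninc alpha_cvg0 alpha_div
  unit_cube_compact iterate_cube C0 _ lipF) pK cp.
- by move=> k; apply: (le_trans (iterate_lip k)); exact: lipC.
- move=> y z yK zK; apply: (le_trans (penalty_lip yK zK)).
  by rewrite ler_wpM2r.
- move=> eps eps0.
  apply: (energy_inequality (x := x) (F := fun k => F (x k)) (phi := piece_gap) (mu := mu)
    (W := fun q k => active_normal q (x k)) (kappa := piece_kind) (C := C)) => //.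
  + exact: ltW.
  + by move=> k; apply: (le_trans (iterate_lip k)); exact: lipC.
  + move=> q k; have /andP[m0 m1] := mu_bound q k; rewrite m0 (le_trans m1) //.
    by rewrite /C; move: CF_ge0; have : 0 <= CF * Gam := mulr_ge0 CF_ge0 Gam_ge0;
       have : 0 <= Cphi * Gam := mulr_ge0 (le_trans ler01 Cphi_ge1) Gam_ge0;
       have : 0 <= 2 * n%:R * Gam ^+ 2 by [rewrite !mulr_ge0 // exprn_ge0]; lra.
  + move=> [j|q] k mk /=.
      rewrite (essential_active penalty_base_cont (iterate_cube k) (mu_ess _ _ mk)).
      by rewrite subrr mulr0 normr0 mulr_ge0 // ltW.
    by apply: (le_trans (mu_face _ _ mk)); exact: lipC.
  + move=> [j|q] bb k e /andP[bk ke] /=; last first.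
      rewrite dot_face_normal.
      rewrite mul0r subr0 addrC addrA subrK subrr normr0.
      by rewrite mulr_ge0 ?(ltW C0) // sqr_ge0.
    set h := elapsed alpha bb e.
    have be := leq_trans bk (ltnW ke).
    have Gh i : (bb <= i <= e)%N -> `|x i - x bb| <= Gam * h.
      move=> /andP[bi ie]; apply: (le_trans (telescope_le iterate_lip bi)).
      rewrite ler_wpM2l // /h (elapsed_cat alpha bi ie) lerDl.
      exact: elapsed_ge0.
    have Ge : `|x e - x k| <= Gam * h.
      apply: (le_trans (telescope_le iterate_lip (ltnW ke))).
      rewrite ler_wpM2l // /h (elapsed_cat alpha bk (ltnW ke)) lerDr.
      exact: elapsed_ge0.
    have Gb := Gh k; rewrite bk (ltnW ke) in Gb; have {}Gb := Gb isT.
    have Gd := Gh e; rewrite be leqnn in Gd; have {}Gd := Gd isT.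
    (* The affine parts cancel. With [u] and [v] the displacements before and after [k], the
       quadratic leaves [|u|^2 - |v|^2], which is second order in [h]. *)
    rewrite [X in `|X|](_ : _ = dot (x e - x bb) ((x k - x bb) - (x e - x k))); last first.
      rewrite /piece_grad /F /penalty /affine_piece.
      rewrite (dotDl (2 *: _)) !dotZl (dotBr (x e) (x bb) (g j)).
      set w := x k - x0; set u := x k - x bb; set v := x e - x k.
      have -> : x e - x bb = u + v by rewrite /u /v [RHS]addrC addrA subrK.
      have -> : x e - x0 = w + v by rewrite /w /v [RHS]addrC addrA subrK.
      have -> : x bb - x0 = w - u by rewrite /w /u opprB [RHS]addrC addrA subrK.
      rewrite -/u -/v; move: w u v => w u v.
      by rewrite sqnormD sqnormB dotBr !dotDl dotDr /sqnorm (dotC v u); ring.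
    apply: (le_trans (dot_le_norm _ _)).
    apply: (@le_trans _ _ (2 * n%:R * Gam ^+ 2 * h ^+ 2)); last first.
      by rewrite ler_wpM2r // sqr_ge0.
    have -> : 2 * n%:R * Gam ^+ 2 * h ^+ 2 = n%:R * ((Gam * h) * (Gam * h + Gam * h)) by ring.
    rewrite ler_wpM2l // ler_pM // (le_trans (ler_normB _ _)) // lerD //.
- move=> y yK ncy; exact: iterate_nondegenerate stepE mu_bound kappa_mu mu_ess mu_face y yK ncy.
- exact: critical_values_finite.
Qed.

End CubePenalty.

(** * The logit margin as a Lipschitz selection of affine functions *)

Section Margin.
Context {R : realType} {n c : nat}.
Variables (Z : 'rV[R]_n -> 'rV[R]_c) (t : 'I_c).

Let runner_up (y : 'rV[R]_n) := sup [set Z y 0 i | i in [set i | i != t]].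

Lemma runner_up_attained y : (2 <= c)%N ->
  exists2 i, i != t & runner_up y = Z y 0 i /\ forall j, j != t -> Z y 0 j <= Z y 0 i.
Proof.
move=> hc.
have [i0 i0t] : exists i0, i0 != t.
  have : (0 < #|predC1 t|)%N by rewrite cardC1 card_ord -subn1 subn_gt0.
  by move=> /card_gt0P[i]; exists i.
case: (@Order.TotalTheory.arg_maxP _ _ _ i0 (fun i => i != t) (fun i => Z y 0 i) i0t) => i it imax.
have ub : ubound [set Z y 0 i | i in [set i | i != t]] (Z y 0 i).
  by move=> _ [j jt <-]; exact: imax.
exists i => //; split=> //; apply/eqP; rewrite eq_le /runner_up.
rewrite ge_sup ?ub_le_sup //; first by exists (Z y 0 i).
- by exists i.
- by exists (Z y 0 i), i.
Qed.

Lemma runner_up_lip (L : R) y z : (2 <= c)%N ->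
  (forall i, `|Z y 0 i - Z z 0 i| <= L) -> `|runner_up y - runner_up z| <= L.
Proof.
move=> hc H; have [i it [-> imax]] := runner_up_attained y hc.
have [j jt [-> jmax]] := runner_up_attained z hc.
have := H i; have := H j; have := imax j jt; have := jmax i it.
by rewrite !ler_norml => ? ? /andP[? ?] /andP[? ?]; apply/andP; split; lra.
Qed.

Lemma margin_lip (L : R) y z : (2 <= c)%N -> (forall i, `|Z y 0 i - Z z 0 i| <= L) ->
  `|margin Z t y - margin Z t z| <= 2 * L.
Proof.
move=> hc H; have := runner_up_lip hc H; have := H t.
rewrite /margin -!/(runner_up _) !ler_norml => /andP[? ?] /andP[? ?].
by rewrite /Num.max; do ! case: ifPn; rewrite -?leNgt => *; apply/andP; split; lra.
Qed.

Hypothesis hZ : relu_logit_map Z.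

Lemma logit_pieces : exists m (A : 'I_m -> 'M[R]_(n, c)) (b : 'I_m -> 'rV[R]_c),
  forall y, unit_cube y -> exists j, Z y = y *m A j + b j.
Proof.
have [_ [m [Q [KE H]]]] := hZ; exists m.
have /choice[A HA] : forall j, exists A : 'M[R]_(n, c), exists b, forall y, Q j y -> Z y = y *m A + b.
  by move=> j; have [_ [A [b Hb]]] := H j; exists A, b.
have /choice[b Hb] := HA; exists A, b => y; rewrite KE => -[j _ Qy]; exists j; exact: Hb.
Qed.

Lemma mulmx_dot m (A : 'M[R]_(n, m)) (y : 'rV[R]_n) i : (y *m A) 0 i = dot (col i A)^T y.
Proof. by rewrite mxE /dot; apply: eq_bigr => k _; rewrite !mxE mulrC. Qed.

(** Each logit is a continuous selection of affine functions; [L] sums the norms of all their linear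
    parts so as to dominate each of them. *)
Lemma logit_lip : exists2 L : R, 0 <= L & forall i y z, unit_cube y -> unit_cube z ->
  `|Z y 0 i - Z z 0 i| <= L * `|y - z|.
Proof.
have [m [A [b HZ]]] := logit_pieces; have [Zc _] := hZ.
pose L := \sum_i \sum_j n%:R * `|(col i (A j))^T|.
have L0 : 0 <= L by apply: sumr_ge0 => i _; apply: sumr_ge0 => j _; rewrite mulr_ge0.
exists L => // i.
have lip1 y z : unit_cube y -> unit_cube z -> Z z 0 i - Z y 0 i <= L * `|z - y|.
  apply: (@piecewise_affine_lip R n _ (fun j => (col i (A j))^T) (fun j => b j 0 i)
    unit_cube (fun y => Z y 0 i)) => //.
  - by move=> *; exact: unit_cube_segment.
  - move=> u e uK e0; have /subspace_continuousP/(_ u uK) cu := Zc.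
    have /cvgrPdist_lt/(_ _ e0) := cu.
    rewrite near_withinE; apply: filterS => w Hw wK.
    by have := coord_le_norm (Z u - Z w) i; rewrite !mxE => /le_lt_trans; apply; exact: Hw.
  - by move=> u /HZ[j ->]; exists j; rewrite mxE mulmx_dot.
  - move=> j v; apply: (le_trans (ler_norm _)); apply: (le_trans (dot_le_norm _ _)).
    rewrite mulrA ler_wpM2r // /L (bigD1 i) //= (bigD1 j) //= -addrA lerDl.
    by apply: addr_ge0; apply: sumr_ge0 => k _; rewrite ?mulr_ge0 //;
      apply: sumr_ge0 => l _; rewrite mulr_ge0.
move=> y z yK zK; rewrite ler_norml; have := lip1 y z yK zK; have := lip1 z y zK yK.
by rewrite [`|z - y|]distrC => *; apply/andP; split; lra.
Qed.

(** [Some (j, i)] stands for the affine piece [j] of the logits with runner-up [i], and [None] for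
    the truncation at 0. *)
Lemma margin_pieces : (2 <= c)%N -> exists (J : finType) (g : J -> 'rV[R]_n) (b : J -> R),
  forall y, unit_cube y -> exists j, margin Z t y = affine_piece g b j y.
Proof.
move=> hc; have [m [A [b HZ]]] := logit_pieces.
exists (option ('I_m * 'I_c)), (fun o => if o is Some (j, i) then
    (col t (A j))^T - (col i (A j))^T else 0),
  (fun o => if o is Some (j, i) then b j 0 t - b j 0 i else 0) => y yK.
rewrite /margin -/(runner_up y); have [i _ [-> _]] := runner_up_attained y hc.
have [j ZE] := HZ y yK.
have [_|_] := leP (Z y 0 t - Z y 0 i) 0.
  by exists None; rewrite /affine_piece dot0l addr0.
by exists (Some (j, i)); rewrite ZE !mxE /affine_piece dotBl -!mulmx_dot !mxE; ring.
Qed.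

End Margin.

Theorem theorem1 (R : realType) (n c : nat) (hn : (1 <= n)%N) (hc : (2 <= c)%N)
    (Z : 'rV[R]_n -> 'rV[R]_c) (hZ : relu_logit_map Z)
    (x0 : 'rV[R]_n) (hx0 : unit_cube x0)
    (t : 'I_c) (ht : class_map Z x0 = Some t) :
  exists2 a0 : R, 0 < a0 & forall a : R, a0 <= a ->
    let F := penalized Z t x0 a in
    forall (alpha : nat -> R) (x G : nat -> 'rV[R]_n),
      (forall k, 0 < alpha k) ->
      (forall k, alpha k.+1 <= alpha k) ->
      alpha @ \oo --> (0 : R) ->
      series alpha @ \oo --> +oo ->
      cvgn (series (fun k => alpha k ^+ 2)) ->
      x 0%N = x0 ->
      (forall k, clarke_gradient unit_cube F (x k) (G k)) ->
      (forall k, x k.+1 = orth_proj unit_cube (x k - alpha k *: G k)) ->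
      forall p : 'rV[R]_n, cluster (x @ \oo) p -> open_cube p ->
        stationary_point unit_cube F p.
Proof.
have [L L0 Zlip] := logit_lip hZ.
have [J [g [b msel]]] := margin_pieces t hZ hc.
(* The threshold 1 is arbitrary: the argument works for every [a > 0]. *)
exists 1 => // a a1 F alpha x G al0 aln alc ald _ xs Gc xst p cp po.
have a0 : 0 < a by exact: lt_le_trans a1.
have mlip y z : unit_cube y -> unit_cube z ->
    `|margin Z t y - margin Z t z| <= 2 * L * `|y - z|.
  by move=> yK zK; rewrite -mulrA; apply: margin_lip => // i; exact: Zlip.
have pK : unit_cube p by move=> i; have /andP[p0 p1] := po i; rewrite !ltW.
exact: (subgradient_cluster a0 (mulr_ge0 (ler0n _ 2) L0) hx0 msel mlip
  al0 aln alc ald xs Gc xst pK cp).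
Qed.
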